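(* Let $M$ be a real $2n$-dimensional manifold. The obstruction to the existence of a generalized almost complex structure on $M$ is the same as that for an almost complex structure, which itself is the same as that for a nondegenerate 2-form (almost symplectic structure). That is, the following are equivalent: $M$ admits a generalized almost complex structure; $M$ admits an almost complex structure; $M$ admits a nondegenerate 2-form.
   Context: A generalized almost complex structure on $M$ is an endomorphism $\mathcal{J}$ of $T\oplus T^*$ with $\mathcal{J}^2=-1$ which is orthogonal with respect to the inner product $\langle X+\xi,Y+\eta\rangle=\frac12(\xi(Y)+\eta(X))$. *)

(* Defs.v *)
From HB Require Import structures.
From mathcomp Require Import all_boot all_order all_algebra.
From mathcomp Require Import all_classical all_reals all_analysis.

Set Implicit Arguments.
Unset Strict Implicit.
Unset Printing Implicit Defensive.

Import Order.TTheory GRing.Theory Num.Theory.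
Import numFieldNormedType.Exports.

Local Open Scope classical_set_scope.
Local Open Scope ring_scope.

(* To be used for open U only: continuity and differentiability are those of
   the total function f at the points of U. *)
Fixpoint Ck (R : realType) (V W : normedModType R) (k : nat)
    (U : set V) (f : V -> W) : Prop :=
  match k with
  | 0 => forall x, U x -> {for x, continuous f}
  | k'.+1 => (forall x, U x -> differentiable f x) /\
             (forall v, Ck k' U (fun x => 'D_v f x))
  end.

Definition smooth_on (R : realType) (V W : normedModType R)
    (U : set V) (f : V -> W) : Prop :=
  forall k, Ck k U f.

(* A smooth structure is given by an atlas, not necessarily maximal.  Charts and
   their inverses are total functions, meaningful only on [chart_dom i] and on
   [chart i @` chart_dom i] respectively. *)
Structure smoothManifold (R : realType) (m : nat) := SmoothManifold {
  carrier :> topologicalType ;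
  manifold_hausdorff : hausdorff_space carrier ;
  manifold_second_countable : @second_countable carrier ;
  chart_index : Type ;
  chart_dom : chart_index -> set carrier ;
  chart : chart_index -> carrier -> 'rV[R]_m ;
  chart_inv : chart_index -> 'rV[R]_m -> carrier ;
  chart_dom_cover : forall p, exists i, chart_dom i p ;
  chart_dom_open : forall i, open (chart_dom i) ;
  chart_cod_open : forall i, open (chart i @` chart_dom i) ;
  chartK : forall i p, chart_dom i p -> chart_inv i (chart i p) = p ;
  chart_continuous : forall i p, chart_dom i p -> {for p, continuous (chart i)} ;
  chart_inv_continuous : forall i x, (chart i @` chart_dom i) x ->
    {for x, continuous (chart_inv i)} ;
  transition_smooth : forall i j,
    smooth_on (chart i @` (chart_dom i `&` chart_dom j)) (chart j \o chart_inv i)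
}.

(* ['J f x] acts on row vectors from the right: v *m 'J f x = 'd f x v.  The
   definition is locked because failed unifications of two Jacobians diverge. *)
HB.lock Definition jac (R : realType) (m : nat) (M : smoothManifold R m)
    (i j : chart_index M) (p : M) : 'M[R]_m :=
  'J (chart j \o chart_inv i) (chart i p).
Canonical jac_unlockable := Unlockable jac.unlock.

Section Bundles.
Context {R : realType} {m : nat} (M : smoothManifold R m).
Implicit Types (p : M) (i j : chart_index M).

Definition chart_at p : chart_index M := sval (cid (chart_dom_cover p)).

(* The tangent space at p is R^m, read in the chart [chart_at p]: the vector X
   stands for the class of curves through p whose velocity in that chart is X.
   Vectors are rows and covectors are columns, so that xi(X) = X *m xi. *)
Definition tangent p : Type := 'rV[R]_m.
Definition cotangent p : Type := 'cV[R]_m.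
HB.instance Definition _ p := GRing.Lmodule.on (tangent p).
HB.instance Definition _ p := GRing.Lmodule.on (cotangent p).

Local Notation gtangent p := (tangent p * cotangent p)%type.

Definition eval p (xi : cotangent p) (X : tangent p) : R :=
  ((X : 'rV[R]_m) *m (xi : 'cV[R]_m)) 0 0.

Definition gpairing p (u v : gtangent p) : R :=
  2%:R^-1 * (eval u.2 v.1 + eval v.2 u.1).

(* Coordinates in the chart i, and the vectors with given coordinates. *)
Definition tcoord i p (X : tangent p) : 'rV[R]_m :=
  (X : 'rV[R]_m) *m jac (chart_at p) i p.
Definition tvec i p (x : 'rV[R]_m) : tangent p := x *m jac i (chart_at p) p.

Definition ccoord i p (xi : cotangent p) : 'cV[R]_m :=
  jac i (chart_at p) p *m (xi : 'cV[R]_m).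
Definition cvec i p (a : 'cV[R]_m) : cotangent p := jac (chart_at p) i p *m a.

Definition gcoord i p (u : gtangent p) : 'rV[R]_m * 'cV[R]_m :=
  (tcoord i u.1, ccoord i u.2).
Definition gvec i p (a : 'rV[R]_m * 'cV[R]_m) : gtangent p :=
  (tvec i p a.1, cvec i p a.2).

(* A field of endomorphisms or of bilinear forms is smooth when its components
   in each chart are: it is evaluated on the fields with constant coordinates. *)
Definition smooth_tangent_endo
    (J : forall p, {linear tangent p -> tangent p}) : Prop :=
  forall i (a : 'rV[R]_m), smooth_on (chart i @` chart_dom i)
    (fun x => let p := chart_inv i x in tcoord i (J p (tvec i p a))).

Definition smooth_gtangent_endo
    (J : forall p, {linear gtangent p -> gtangent p}) : Prop :=
  forall i (a : 'rV[R]_m * 'cV[R]_m), smooth_on (chart i @` chart_dom i)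
    (fun x => let p := chart_inv i x in gcoord i (J p (gvec i p a))).

Definition smooth_form (w : forall p, {biscalar tangent p}) : Prop :=
  forall i (a b : 'rV[R]_m), smooth_on (chart i @` chart_dom i)
    (fun x => let p := chart_inv i x in w p (tvec i p a) (tvec i p b)).

Definition almost_complex (J : forall p, {linear tangent p -> tangent p}) : Prop :=
  smooth_tangent_endo J /\ forall p X, J p (J p X) = - X.

Definition generalized_almost_complex
    (J : forall p, {linear gtangent p -> gtangent p}) : Prop :=
  [/\ smooth_gtangent_endo J,
      forall p u, J p (J p u) = - u &
      forall p u v, gpairing (J p u) (J p v) = gpairing u v].

Definition two_form (w : forall p, {biscalar tangent p}) : Prop :=
  smooth_form w /\ forall p X, w p X X = 0.

Definition nondegenerate_form (w : forall p, {biscalar tangent p}) : Prop :=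
  forall p X, (forall Y, w p X Y = 0) -> X = 0.

End Bundles.

Notation gtangent p := (tangent p * cotangent p)%type.

(* Main.v *)
(** A nondegenerate 2-form yields an almost complex structure by polar
    decomposition relative to a Riemannian metric.  Conversely, for any metric
    [g], both other structures yield nondegenerate 2-forms by a formula without
    square roots: [g (J X, Y) - g (X, J Y)] for an almost complex structure [J],
    and [<J (X + g X), Y + g Y>] for a generalized one.  The latter is
    nondegenerate because [J] preserves the pairing: if [J (X + g X)] were
    orthogonal to the graph of [g], it would lie in the graph of [- g], where the
    pairing is negative, although its square is [g (X, X)].  Finally [J] yields
    the generalized structure [(J, - J^* )].

    The polar decomposition is smooth because the square root of a positive
    definite matrix is: the difference of two roots solves a Sylvester equation
    [S D + D T = E], which is uniquely solvable for positive definite [S] and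
    [T], and this gives continuity, differentiability, and a formula for the
    derivative which bootstraps to all orders. *)

Require Import Defs.
From HB Require Import structures.
From mathcomp Require Import all_boot all_order all_algebra.
From mathcomp Require Import ring lra complex.
From mathcomp Require Import all_classical all_reals all_analysis.

Set Implicit Arguments.
Unset Strict Implicit.
Unset Printing Implicit Defensive.

Import Order.TTheory GRing.Theory Num.Theory.
Import numFieldNormedType.Exports.

Local Open Scope classical_set_scope.
Local Open Scope ring_scope.

(** * Positive definite matrices *)

Section PositiveDefinite.
Context {R : realFieldType}.

(** The tangent space at [p] is read in [chart_at p], an arbitrary choice that may jump from point
    to point, so a matrix field in these frames need not be smooth as a function. Each construction
    is therefore made pointwise in that frame and must commute with change of basis; smoothness is
    then checked in a fixed chart. Plain square roots do not commute with congruence. The geometric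
    mean does: it is the unique positive definite solution [K] of [K G^-1 K = B], an equation that
    congruence preserves. Its uniqueness yields both the transformation law of the compatible
    complex structure and the identity [J^2 = -1]. The metric must be global: it is glued from
    bump-weighted Euclidean metrics indexed by a countable base, with weights that need not sum to
    one, because one definite term among semidefinite ones suffices. *)

Definition posdef n (A : 'M[R]_n) : Prop :=
  A^T = A /\ forall v : 'rV_n, v != 0 -> 0 < (v *m A *m v^T) 0 0.

Definition possemidef n (A : 'M[R]_n) : Prop :=
  A^T = A /\ forall v : 'rV_n, 0 <= (v *m A *m v^T) 0 0.

Lemma mulmx_trE n (v : 'rV[R]_n) : (v *m v^T) 0 0 = \sum_i v 0 i ^+ 2.
Proof. by rewrite !mxE; apply: eq_bigr => i _; rewrite !mxE expr2. Qed.

Lemma mulmx_tr_ge0 n (v : 'rV[R]_n) : 0 <= (v *m v^T) 0 0.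
Proof. by rewrite mulmx_trE sumr_ge0// => i _; rewrite sqr_ge0. Qed.

Lemma mulmx_tr_gt0 n (v : 'rV[R]_n) : v != 0 -> 0 < (v *m v^T) 0 0.
Proof.
move=> v0; rewrite lt_neqAle mulmx_tr_ge0 andbT eq_sym.
apply: contra v0; rewrite mulmx_trE psumr_eq0 => [/allP v0|i _]; last exact: sqr_ge0.
apply/eqP/rowP => i; apply/eqP; rewrite mxE -sqrf_eq0.
by apply: v0; rewrite mem_index_enum.
Qed.

Lemma posdef_semi n (A : 'M[R]_n) : posdef A -> possemidef A.
Proof.
move=> [As Ap]; split=> // v; have [->|/Ap/ltW//] := eqVneq v 0.
by rewrite !mul0mx mxE.
Qed.

Lemma possemidef_tr n p (A : 'M[R]_n) (D : 'M[R]_(p, n)) :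
  possemidef A -> possemidef (D *m A *m D^T).
Proof.
move=> [As Ap]; split=> [|v]; first by rewrite !trmx_mul trmxK As mulmxA.
by have := Ap (v *m D); rewrite trmx_mul !mulmxA.
Qed.

Lemma posdef1 n : posdef (1%:M : 'M[R]_n).
Proof. by split=> [|v /mulmx_tr_gt0]; rewrite ?trmx1// mulmx1. Qed.

Lemma posdef_unitmx n (A : 'M[R]_n) : posdef A -> A \in unitmx.
Proof.
move=> [_ Ap]; rewrite -row_free_unit; apply: inj_row_free => v vA.
by apply: contraPeq isT => /Ap; rewrite vA mul0mx mxE ltxx.
Qed.

Lemma posdef_congr n (T A : 'M[R]_n) :
  T \in unitmx -> posdef A -> posdef (T *m A *m T^T).
Proof.
move=> Tu Ap; have [Ts _] := possemidef_tr T (posdef_semi Ap).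
split=> // v v0; have /Ap.2 : v *m T != 0.
  by apply: contra v0 => /eqP/(congr1 (mulmx^~ (invmx T))); rewrite mulmxK// mul0mx => ->.
by rewrite trmx_mul !mulmxA.
Qed.

Lemma posdef_inv n (A : 'M[R]_n) : posdef A -> posdef (invmx A).
Proof.
move=> Ap; have Au := posdef_unitmx Ap.
suff -> : invmx A = invmx A *m A *m (invmx A)^T.
  by apply: posdef_congr; rewrite ?unitmx_inv.
by rewrite mulVmx// mul1mx trmx_inv Ap.1.
Qed.

Lemma possemidef0 n : possemidef (0 : 'M[R]_n).
Proof. by split=> [|v]; rewrite ?trmx0// mulmx0 mul0mx mxE. Qed.

Lemma possemidefD n (A B : 'M[R]_n) :
  possemidef A -> possemidef B -> possemidef (A + B).
Proof.
move=> [As Ap] [Bs Bp]; split=> [|v]; first by rewrite linearD /= As Bs.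
by rewrite mulmxDr mulmxDl mxE addr_ge0.
Qed.

Lemma possemidefZ n (c : R) (A : 'M[R]_n) :
  0 <= c -> possemidef A -> possemidef (c *: A).
Proof.
move=> c0 [As Ap]; split=> [|v]; first by rewrite linearZ /= As.
by rewrite -scalemxAr -scalemxAl mxE mulr_ge0.
Qed.

Lemma posdefZ n (c : R) (A : 'M[R]_n) : 0 < c -> posdef A -> posdef (c *: A).
Proof.
move=> c0 [As Ap]; split=> [|v /Ap v0]; first by rewrite linearZ /= As.
by rewrite -scalemxAr -scalemxAl mxE mulr_gt0.
Qed.

Lemma possemidef_sum n (I : Type) (r : seq I) (P : pred I) (F : I -> 'M[R]_n) :
  (forall i, P i -> possemidef (F i)) -> possemidef (\sum_(i <- r | P i) F i).
Proof.
by move=> FP; apply: (big_ind (@possemidef n)) => //;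
  [exact: possemidef0|exact: possemidefD].
Qed.

Lemma posdefDl n (A B : 'M[R]_n) : posdef A -> possemidef B -> posdef (A + B).
Proof.
move=> [As Ap] [Bs Bp]; split=> [|v /Ap v0]; first by rewrite linearD /= As Bs.
by rewrite mulmxDr mulmxDl mxE ltr_wpDr.
Qed.

Lemma mxtrace_tr_ge0 p q (D : 'M[R]_(p, q)) : 0 <= \tr (D *m D^T).
Proof.
rewrite /mxtrace sumr_ge0// => i _; rewrite mxE sumr_ge0// => j _.
by rewrite mxE -expr2 sqr_ge0.
Qed.

Lemma sqr_le_mxtrace p q (D : 'M[R]_(p, q)) i j : D i j ^+ 2 <= \tr (D *m D^T).
Proof.
have -> : \tr (D *m D^T) = \sum_a \sum_b D a b ^+ 2.
  by apply: eq_bigr => a _; rewrite mxE; apply: eq_bigr => b _; rewrite mxE expr2.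
rewrite (bigD1 i)//= (bigD1 j)//= -addrA lerDl addr_ge0// sumr_ge0// => *.
  exact: sqr_ge0.
by apply: sumr_ge0 => *; exact: sqr_ge0.
Qed.

Lemma mxtrace_tr_eq0 p q (D : 'M[R]_(p, q)) : \tr (D *m D^T) <= 0 -> D = 0.
Proof.
move=> D0; apply/matrixP => i j; rewrite mxE; apply/eqP; rewrite -sqrf_eq0.
by rewrite eq_le sqr_ge0 andbT (le_trans (sqr_le_mxtrace _ _ _)).
Qed.

Lemma mxtrace_form p n (D : 'M[R]_(p, n)) (A : 'M[R]_n) :
  \tr (D *m A *m D^T) = \sum_i (row i D *m A *m (row i D)^T) 0 0.
Proof.
apply: eq_bigr => i _; rewrite -row_mul !mxE.
by apply: eq_bigr => j _; rewrite !mxE.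
Qed.

(* With [q] the form of [A], Cauchy-Schwarz gives
   [v_i^2 <= q v * (A^-1)_ii]; it is proved by evaluating [q] at the difference
   of [v] and a multiple of [e_i A^-1]. *)
Lemma posdef_lower_bound n (A : 'M[R]_n) : posdef A ->
  exists2 c, 0 < c & forall v : 'rV_n, c * (v *m v^T) 0 0 <= (v *m A *m v^T) 0 0.
Proof.
move=> Ap; have Au := posdef_unitmx Ap; have [Bs Bp] := posdef_inv Ap.
set B := invmx A in Bs Bp.
have Bd i : 0 < B i i.
  have /Bp : delta_mx 0 i != 0 :> 'rV[R]_n.
    apply/eqP => /matrixP /(_ 0 i); rewrite !mxE !eqxx /=.
    by move/eqP; rewrite oner_eq0.
  by rewrite -rowE trmx_delta -colE !mxE.
have cs (v : 'rV_n) i : v 0 i ^+ 2 <= (v *m A *m v^T) 0 0 * B i i.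
  pose u := row i B; pose t := v 0 i / B i i.
  have uA : u *m A = delta_mx 0 i by rewrite -row_mul mulVmx// rowE mulmx1.
  have Au' : A *m u^T = (delta_mx 0 i)^T by rewrite -[A in LHS]Ap.1 -trmx_mul uA.
  have := (posdef_semi Ap).2 (v - t *: u).
  have -> : (v - t *: u)^T = v^T - t *: u^T by rewrite linearB linearZ.
  rewrite mulmxBl -scalemxAl uA mulmxBr -!scalemxAr !mulmxBl -!scalemxAl.
  rewrite -(mulmxA v A u^T) Au'.
  have -> : (v *m (delta_mx 0 i)^T) = (v 0 i)%:M.
    by rewrite trmx_delta -colE; apply/matrixP => a b; rewrite !ord1 !mxE eqxx.
  have -> : (delta_mx 0 i *m v^T) = (v 0 i)%:M.
    by rewrite -rowE; apply/matrixP => a b; rewrite !ord1 !mxE eqxx.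
  have -> : (delta_mx 0 i *m u^T) = (B i i)%:M.
    by rewrite -rowE; apply/matrixP => a b; rewrite !ord1 !mxE eqxx.
  rewrite !mxE eqxx !mulr1n => q0.
  have : t * B i i = v 0 i by rewrite /t divfK// gt_eqF.
  move: q0 (Bd i); nra.
(* Summing [cs] over [i] bounds [v v^T] by the form of [A] times [\tr B]; the added 1 keeps the
   constant positive when [n = 0]. *)
exists (1 + \tr B)^-1 => [|v].
  by rewrite invr_gt0 ltr_pwDl// sumr_ge0// => i _; rewrite ltW.
rewrite mulrC ler_pdivrMr; last first.
  by rewrite ltr_pwDl// sumr_ge0// => i _; rewrite ltW.
rewrite mulrDr mulr1 ler_wpDl// ?(posdef_semi Ap).2//.
by rewrite mulmx_trE mulr_sumr ler_sum.
Qed.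

(** Pairing [E = S D + D T] with [D] in the trace inner product gives at least [c |D|^2] from [T],
    the [S] part being nonnegative; [|E - c D|^2 >= 0] then replaces Cauchy-Schwarz. The constant
    depends on [T] alone, which continuity of the root needs, since there [S] is the root at a
    moving point. *)
Lemma sylvester_lower_bound n (T : 'M[R]_n) : posdef T ->
  exists2 c, 0 < c & forall S D : 'M[R]_n, posdef S ->
    c * \tr (D *m D^T) <= \tr ((S *m D + D *m T) *m (S *m D + D *m T)^T).
Proof.
move=> /posdef_lower_bound [c c0 cT]; exists (c ^+ 2) => [|S D Sp].
  by rewrite exprn_gt0.
set E := _ + _.
have h1 : c * \tr (D *m D^T) <= \tr (D^T *m E).
  rewrite mulmxDr !mxtraceD ler_wpDl//.
    have -> : D^T *m (S *m D) = D^T *m S *m D^T^T by rewrite trmxK mulmxA.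
    by rewrite mxtrace_form sumr_ge0// => i _; exact: (posdef_semi Sp).2.
  rewrite [leRHS]mxtrace_mulC mxtrace_form -[X in \tr (X *m _)]mulmx1 mxtrace_form.
  by rewrite mulr_sumr ler_sum// => i _; rewrite mulmx1.
have : 0 <= \tr ((E - c *: D) *m (E - c *: D)^T) by exact: mxtrace_tr_ge0.
have -> : (E - c *: D)^T = E^T - c *: D^T by rewrite linearB linearZ.
rewrite mulmxBl !mulmxBr -!scalemxAl -!scalemxAr.
rewrite 2!raddfB /= !mxtraceZ raddfB /= !mxtraceZ.
have -> : \tr (E *m D^T) = \tr (D^T *m E) by rewrite mxtrace_mulC.
have -> : \tr (D *m E^T) = \tr (D^T *m E).
  by rewrite -mxtrace_tr trmx_mul trmxK mxtrace_mulC.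
move: h1; set a := \tr (D^T *m E); set b := \tr (D *m D^T).
nra.
Qed.

Lemma sylvester_inj n (S T D : 'M[R]_n) :
  posdef S -> posdef T -> S *m D + D *m T = 0 -> D = 0.
Proof.
move=> Sp /sylvester_lower_bound[c c0 /(_ S D Sp)] + E0.
by rewrite E0 mul0mx mxtrace0 pmulr_rle0// => /mxtrace_tr_eq0.
Qed.

Lemma posdef_sqrt_unique n (S T : 'M[R]_n) :
  posdef S -> posdef T -> S *m S = T *m T -> S = T.
Proof.
move=> Sp Tp ST; apply/eqP; rewrite -subr_eq0; apply/eqP.
apply: (sylvester_inj Sp Tp).
by rewrite mulmxBr mulmxBl ST addrC subrKA subrr.
Qed.

End PositiveDefinite.

(** Newton interpolation: a new node is corrected by a multiple of the polynomial vanishing at the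
    earlier ones. It turns a function of the eigenvalues into a polynomial in the matrix. *)
Lemma interpolation_exists (F : fieldType) (f : F -> F) (s : seq F) :
  exists p : {poly F}, {in s, forall x, p.[x] = f x}.
Proof.
elim: s => [|a s [p ps]]; first by exists 0.
have [as_|as_] := boolP (a \in s).
  by exists p => x; rewrite inE => /predU1P[->|]; exact: ps.
pose q : {poly F} := \prod_(b <- s) ('X - b%:P).
have qa : q.[a] != 0.
  by rewrite -[_ == 0]/(root q a) root_prod_XsubC.
exists (p + ((f a - p.[a]) / q.[a]) *: q) => x; rewrite inE hornerD hornerZ.
move=> /predU1P[->|xs]; first by rewrite divfK// addrC subrK.
have /rootP -> : root q x by rewrite root_prod_XsubC.
by rewrite mulr0 addr0 ps.
Qed.

Lemma posdef_eigenvalue_gt0 (R : realFieldType) n (A : 'M[R]_n) (r : R) :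
  posdef A -> eigenvalue A r -> 0 < r.
Proof.
move=> [_ Ap] /eigenvalueP[v vA v0]; have := Ap v v0.
rewrite vA -scalemxAl mxE pmulr_lgt0//; exact: mulmx_tr_gt0.
Qed.

Local Notation toC := (real_complex _).

(** A real symmetric matrix is hermitian, so the spectral theorem over [R[i]] applies and the
    eigenvalues are real. Each is a root of the characteristic polynomial of [A], hence an
    eigenvalue over [R], hence positive. *)
Lemma posdef_diag (R : rcfType) n (A : 'M[R]_n) : posdef A ->
  exists (U : 'M[R[i]]_n) (d : 'rV[R]_n),
    [/\ U \in unitmx, forall i, 0 < d 0 i &
        map_mx toC A = invmx U *m diag_mx (map_mx toC d) *m U].
Proof.
move=> Ap; pose Ac := map_mx toC A.
have Ah : Ac \is hermsymmx.
  apply: realsym_hermsym; last first.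
    by apply/mxOverP => i j; rewrite mxE; apply/complex_realP; exists (A i j).
  apply/is_hermitianmxP; rewrite expr0 scale1r; apply/matrixP => i j.
  by rewrite !mxE -[in LHS]Ap.1 mxE.
have /mxOverP dreal := hermitian_spectral_diag_real Ah.
have /orthomx_spectralP AE := hermitian_normalmx Ah.
set U := spectralmx Ac in AE; have Uu : U \in unitmx by exact: spectral_unit.
pose d : 'rV[R]_n := map_mx (@complex.Re R) (spectral_diag Ac).
have dE : map_mx toC d = spectral_diag Ac.
  by apply/matrixP => i j; rewrite !mxE RRe_real.
exists U, d; split=> [//|i|]; last by rewrite dE.
apply: (posdef_eigenvalue_gt0 Ap).
rewrite eigenvalue_root_char -(fmorph_root toC) map_char_poly.
rewrite -eigenvalue_root_char; apply/eigenvalueP; exists (row i U).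
  rewrite -/Ac -row_mul [in LHS]AE -dE mulmxA mulKVmx//.
  by apply/rowP => j; rewrite mxE mul_diag_mx !mxE.
apply/eqP => Ui0; have : (delta_mx 0 i : 'rV_n) *m U *m invmx U = 0 by rewrite -rowE Ui0 mul0mx.
rewrite mulmxK// => /matrixP/(_ 0 i); rewrite !mxE !eqxx => /eqP.
by rewrite oner_eq0.
Qed.

(* Writing [A = B^4] with [B] a polynomial in [A], hence symmetric, makes
   [B *m B] evidently positive. *)
Lemma posdef_sqrt_exists (R : rcfType) n (A : 'M[R]_n) : posdef A ->
  exists2 S, posdef S & S *m S = A.
Proof.
case: n A => [A Ap|n A Ap].
  by exists A => //; apply/matrixP => -[].
have [U [d [Uu d0 AE]]] := posdef_diag Ap.
(* [f] is the fourth root. The interpolating polynomial has real coefficients, so [B] is a real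
   matrix although the diagonalisation is complex. *)
pose f (x : R) := Num.sqrt (Num.sqrt x).
have [q qf] := interpolation_exists f [seq d 0 i | i <- enum 'I_n.+1].
pose B := horner_mx A q.
have B4 : B *m B *m (B *m B) = A.
  apply: (@map_mx_inj _ _ toC); rewrite !map_mxM map_horner_mx AE horner_mx_uconjC//.
  have conjM (X Y : 'M[R[i]]_n.+1) :
      invmx U *m X *m U *m (invmx U *m Y *m U) = invmx U *m (X *m Y) *m U.
    by rewrite !mulmxA mulmxK.
  rewrite horner_mx_diag !conjM !mulmx_diag.
  congr (invmx U *m diag_mx _ *m U); apply/rowP => i.
  rewrite !mxE horner_map -!rmorphM qf; last by rewrite map_f// mem_enum.
  have s0 := d0 i; congr toC; rewrite -[f _ * f _]expr2 /f sqr_sqrtr ?sqrtr_ge0//.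
  by rewrite -expr2 sqr_sqrtr// ltW.
have Bs : B^T = B.
  rewrite /B; elim/poly_ind: q {qf B B4} => [|p c IHp].
    by rewrite rmorph0 trmx0.
  rewrite rmorphD rmorphM /= horner_mx_C horner_mx_X linearD /= tr_scalar_mx.
  congr (_ + _); rewrite -{1}mulmxE trmx_mul IHp Ap.1 mulmxE.
  exact: comm_mx_horner (comm_mx_refl A).
have Bu : B \in unitmx.
  by have := posdef_unitmx Ap; rewrite -B4 !unitmx_mul => /andP[/andP[]].
exists (B *m B) => //.
rewrite -{2}Bs -[X in X *m _]mulmx1.
exact: posdef_congr (posdef1 _).
Qed.

(** * Geometric mean and compatible complex structures *)

Lemma invmx_mul (R : comUnitRingType) n (A B : 'M[R]_n) :
  A \in unitmx -> B \in unitmx -> invmx (A *m B) = invmx B *m invmx A.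
Proof.
move=> Au Bu; have ABu : A *m B \in unitmx by rewrite unitmx_mul Au.
apply: (can_inj (mulKmx ABu)).
by rewrite mulmxV// mulmxA mulmxK// mulmxV.
Qed.

Section GeometricMean.
Context {R : rcfType} {n : nat}.
Implicit Types A B G K S T W : 'M[R]_n.

Definition mxsqrt A : 'M[R]_n := xget 0 [set S | posdef S /\ S *m S = A]%classic.

Lemma mxsqrtP A : posdef A -> posdef (mxsqrt A) /\ mxsqrt A *m mxsqrt A = A.
Proof.
move=> /posdef_sqrt_exists[S Sp SA].
by have /(xgetPex 0) : exists T, [set T | posdef T /\ T *m T = A]%classic T by exists S.
Qed.

Lemma mxsqrt_unique A S : posdef S -> S *m S = A -> S = mxsqrt A.
Proof.
move=> Sp SA; suff /mxsqrtP[Tp TA] : posdef A.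
  by apply: posdef_sqrt_unique; rewrite // SA TA.
rewrite -SA -[X in _ *m X]Sp.1 -[X in X *m _]mulmx1.
exact: posdef_congr (posdef_unitmx Sp) (posdef1 _).
Qed.

(** The geometric mean of two positive definite matrices, [G^(1/2) (G^(-1/2) B G^(-1/2))^(1/2)
    G^(1/2)]. *)
Definition gmean G B : 'M[R]_n :=
  let H := mxsqrt G in H *m mxsqrt (invmx H *m B *m invmx H) *m H.

Lemma gmean_arg_posdef G B : posdef G -> posdef B ->
  posdef (invmx (mxsqrt G) *m B *m invmx (mxsqrt G)).
Proof.
move=> /mxsqrtP[Hp _] Bp; have [Hs _] := posdef_inv Hp.
by rewrite -[X in _ *m X]Hs; apply: posdef_congr; rewrite ?unitmx_inv ?posdef_unitmx.
Qed.

Lemma gmean_posdef G B : posdef G -> posdef B -> posdef (gmean G B).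
Proof.
move=> Gp Bp; have [Hp _] := mxsqrtP Gp.
have [Sp _] := mxsqrtP (gmean_arg_posdef Gp Bp).
rewrite /gmean; set S := mxsqrt (_ *m _) in Sp *.
by rewrite -[X in _ *m X]Hp.1; apply: posdef_congr => //; exact: posdef_unitmx.
Qed.

Lemma gmeanE G B : posdef G -> posdef B ->
  gmean G B *m invmx G *m gmean G B = B.
Proof.
move=> Gp Bp; have [Hp HG] := mxsqrtP Gp; have Hu := posdef_unitmx Hp.
have [_ SB] := mxsqrtP (gmean_arg_posdef Gp Bp).
rewrite /gmean; set H := mxsqrt G in Hp HG Hu SB *; set S := mxsqrt _ in SB *.
rewrite -HG invmx_mul//.
rewrite !mulmxA mulmxK// -(mulmxA _ (invmx H) H) mulVmx// mulmx1.
by rewrite -(mulmxA H S S) SB -!mulmxA mulVmx// mulmx1 mulKVmx.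
Qed.

(** Conjugating by [H^-1], with [H] the root of [G], turns [K G^-1 K] into the square of
    [H^-1 K H^-1], so uniqueness of the root applies. In this form any solution of the defining
    equation can be rewritten as a geometric mean. *)
Lemma gmean_unique G K : posdef G -> posdef K ->
  K = gmean G (K *m invmx G *m K).
Proof.
move=> Gp Kp; have [Hp HG] := mxsqrtP Gp; have Hu := posdef_unitmx Hp.
rewrite /gmean; set H := mxsqrt G in Hp HG Hu *.
rewrite -HG invmx_mul// -(@mxsqrt_unique _ (invmx H *m K *m invmx H)); last first.
- by rewrite !mulmxA.
- exact: gmean_arg_posdef.
by rewrite -!mulmxA mulVmx// mulmx1 mulKVmx.
Qed.

End GeometricMean.

(* Polar decomposition relative to the inner product [G]: the alternating form
   [W] becomes symmetric positive definite, with matrix [gmean], after applying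
   the complex structure to its second argument. *)
Section CompatibleComplexStructure.
Context {R : rcfType} {n : nat}.
Implicit Types G T W : 'M[R]_n.

Definition compat_acs G W : 'M[R]_n :=
  (invmx W *m gmean G (W *m invmx G *m W^T))^T.

Lemma compat_acs_sqr G W : posdef G -> W^T = - W -> W \in unitmx ->
  compat_acs G W *m compat_acs G W = - 1%:M.
Proof.
move=> Gp Ws Wu; rewrite /compat_acs -trmx_mul.
have Bp : posdef (W *m invmx G *m W^T) by exact/posdef_congr/posdef_inv.
have Kp := gmean_posdef Gp Bp; have KE := gmeanE Gp Bp.
move Bdef: (W *m _ *m _) Bp Kp KE => B Bp.
move Kdef: (gmean G B) => K Kp KE.
have Ku := posdef_unitmx Kp.
(* [W K^-1 W^T] solves the equation defining [K]: skew-symmetry turns the inner [W^T G^-1 W] into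
   [W G^-1 W^T = K G^-1 K], and the factors [K] cancel. Uniqueness then gives [K = - W K^-1 W], that
   is [(W^-1 K)^2 = -1]. *)
have LK : W *m invmx K *m W^T = K.
  have Lp : posdef (W *m invmx K *m W^T) by exact/posdef_congr/posdef_inv.
  rewrite [LHS](gmean_unique Gp Lp) -[RHS]Kdef; congr gmean.
  have -> : W *m invmx K *m W^T *m invmx G *m (W *m invmx K *m W^T) =
     W *m invmx K *m (W *m invmx G *m W^T) *m invmx K *m W^T.
    by rewrite Ws !(mulmxN, mulNmx) !mulmxA.
  rewrite Bdef -{1}KE !mulmxA -(mulmxA W (invmx K) K) mulVmx// mulmx1.
  by rewrite -(mulmxA _ K (invmx K)) mulmxV// mulmx1.
have KN : K = - (W *m invmx K *m W) by rewrite -[LHS]LK Ws mulmxN.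
suff -> : invmx W *m K *m (invmx W *m K) = - 1%:M by rewrite linearN /= trmx1.
rewrite {1}KN mulmxN mulNmx; congr (- _).
by rewrite !mulmxA mulVmx// mul1mx mulmxK// mulVmx.
Qed.

(** [T K T^T] solves the transformed equation, hence is the transformed mean. Consequently the
    structure defined in the frame of [chart_at p] is given by the same formula in every chart
    around [p]. *)
Lemma compat_acs_congr G W T : posdef G -> W \in unitmx -> T \in unitmx ->
  compat_acs (T *m G *m T^T) (T *m W *m T^T) = T *m compat_acs G W *m invmx T.
Proof.
move=> Gp Wu Tu; rewrite /compat_acs.
have Bp : posdef (W *m invmx G *m W^T) by exact/posdef_congr/posdef_inv.
have Kp := gmean_posdef Gp Bp; have KE := gmeanE Gp Bp.
move Bdef: (W *m _ *m _) Bp Kp KE => B Bp.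
move Kdef: (gmean G B) => K Kp KE.
have Gu := posdef_unitmx Gp.
have TTu : T^T \in unitmx by rewrite unitmx_tr.
have inv3 (X : 'M[R]_n) : X \in unitmx ->
    invmx (T *m X *m T^T) = invmx T^T *m invmx X *m invmx T.
  by move=> Xu; rewrite !invmx_mul ?unitmx_mul ?Tu ?Xu// mulmxA.
have -> : T *m W *m T^T *m invmx (T *m G *m T^T) *m (T *m W *m T^T)^T =
    (T *m K *m T^T) *m invmx (T *m G *m T^T) *m (T *m K *m T^T).
  rewrite inv3// !trmx_mul trmxK; transitivity (T *m B *m T^T).
    by rewrite -Bdef !mulmxA mulmxK// mulmxKV.
  by rewrite -KE !mulmxA mulmxK// mulmxKV.
rewrite -gmean_unique; [|exact: posdef_congr|exact: posdef_congr].
rewrite inv3// !mulmxA -(mulmxA _ (invmx T) T) mulVmx// mulmx1.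
by rewrite !trmx_mul !trmx_inv !trmxK !mulmxA.
Qed.

End CompatibleComplexStructure.

(** * Functions of class C^k *)

Section CkGeneral.
Context {R : realType}.
Implicit Types (V W X : normedModType R) (k : nat).

Lemma is_diff_epsP V W (f : V -> W) x (L : {linear V -> W}) :
  continuous L ->
  (forall e, 0 < e -> \forall h \near 0, `|f (h + x) - f x - L h| <= e * `|h|) ->
  is_diff x f L.
Proof.
move=> Lc fL; have fE : f \o shift x = cst (f x) + L +o_ 0 id.
  apply/eqaddoP => e e0; near=> h.
  have -> : (f \o shift x - (cst (f x) + L)) h = f (h + x) - f x - L h.
    by rewrite -[LHS]/(f (h + x) - (f x + L h)) opprD addrA.
  by near: h; exact: fL.
have dfE := diff_unique Lc fE.
by apply: DiffDef => //; apply/diff_locallyP; rewrite dfE.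
Unshelve. all: by end_near. Qed.

Lemma near_eq_differentiable V W (f g : V -> W) x :
  (\near x, f x = g x) -> differentiable f x -> differentiable g x.
Proof.
move=> fg /diff_locallyP[fc fE].
suff [] : is_diff x g ('d f x) by [].
apply: is_diff_epsP => // e e0.
have gx := nbhs_singleton fg.
move/eqaddoP : fE => /(_ e e0) fE.
have fg0 : \forall h \near 0, f (h + x) = g (h + x).
  by move/nbhs0P : fg; apply: filterS => h; rewrite addrC.
near=> h; have -> : g (h + x) - g x - 'd f x h = f (h + x) - f x - 'd f x h.
  by rewrite -gx (near fg0 h).
have -> : f (h + x) - f x - 'd f x h = (f \o shift x - (cst (f x) + 'd f x)) h.
  by rewrite -[RHS]/(f (h + x) - (f x + 'd f x h)) opprD addrA.
by near: h.
Unshelve. all: by end_near. Qed.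

(** Continuity and derivatives are those of the total function, so the condition on [U] is a
    conjunction over its points. Restriction and localisation follow. *)
Lemma CkP V W k (U : set V) (f : V -> W) :
  Ck k U f <-> forall x, U x -> Ck k [set x] f.
Proof.
elim: k f => [|k IH] f /=; first by split=> [fU x Ux _ ->|fU x Ux]; [exact: fU|exact: (fU x Ux)].
split=> [[fU DfU] x Ux|fU].
  split=> [_ ->|v]; [exact: fU|by have /IH/(_ x Ux) := DfU v].
split=> [x /fU[/(_ x erefl)//]|v].
by apply/IH => x /fU[_ /(_ v)].
Qed.

Lemma Ck_sub V W k (U U' : set V) (f : V -> W) : U' `<=` U -> Ck k U f -> Ck k U' f.
Proof. by move=> UU /CkP fU; apply/CkP => x /UU; exact: fU. Qed.

Lemma Ck_local V W k (U : set V) (f : V -> W) :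
  (forall x, U x -> exists2 U', U' x & Ck k U' f) -> Ck k U f.
Proof. by move=> fU; apply/CkP => x /fU[U' U'x /CkP]; exact. Qed.

Lemma eq_near_open V W (U : set V) (f g : V -> W) x : open U -> U x ->
  (forall y, U y -> f y = g y) -> \near x, f x = g x.
Proof. by move=> Uo Ux fg; apply: filterS fg _; exact: open_nbhs_nbhs. Qed.

(** Openness makes the functions agree near each point of [U], so that their derivatives agree on
    [U] as well. Formulas valid only on a chart codomain are exchanged in this way. *)
Lemma eq_Ck V W k (U : set V) (f g : V -> W) : open U ->
  (forall x, U x -> f x = g x) -> Ck k U f -> Ck k U g.
Proof.
move=> Uo; elim: k f g => [|k IH] f g fg /=.
  move=> fU x Ux; have fgx := eq_near_open Uo Ux fg.
  move: (fU x Ux); rewrite /prop_for /continuous_at (fg x Ux).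
  by apply: cvg_trans; exact: near_eq_cvg.
move=> [fU DfU]; split=> [x Ux|v].
  by apply: near_eq_differentiable (fU x Ux); exact: eq_near_open fg.
apply: IH (DfU v) => x Ux.
by apply: near_eq_derive; exact: eq_near_open fg.
Qed.

Lemma CkS V W k (U : set V) (f : V -> W) : Ck k.+1 U f -> Ck k U f.
Proof.
elim: k f => [|k IH] f [fU DfU].
  by move=> x /fU /differentiable_continuous.
by split=> // v; apply: IH; exact: DfU.
Qed.

Lemma Ck_continuous V W k (U : set V) (f : V -> W) x :
  Ck k U f -> U x -> {for x, continuous f}.
Proof. by elim: k => [fU /fU//|k IH /CkS]; exact: IH. Qed.

Lemma Ck_cst V W k (U : set V) (c : W) : Ck k U (fun=> c).
Proof.
elim: k c => [|k IH] c /=; first by move=> x _; exact: cvg_cst.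
split=> [x _|v]; first exact: differentiable_cst.
suff -> : (fun x => 'D_v (fun=> c) x) = (fun=> 0 : W) by exact: IH.
by apply/funext => x; exact: derive_cst.
Qed.

Lemma Ck_id V k (U : set V) : Ck k U (fun x : V => x).
Proof.
case: k => [|k]; first by move=> x _; exact: cvg_id.
split=> [x _|v]; first by apply: (linear_differentiable (f := idfun)) => y; exact: cvg_id.
suff -> : (fun x => 'D_v (fun x : V => x) x) = (fun=> v) by exact: Ck_cst.
by apply/funext => x; exact: derive_id.
Qed.

Lemma CkD V W k (U : set V) (f g : V -> W) : open U ->
  Ck k U f -> Ck k U g -> Ck k U (fun x => f x + g x).
Proof.
move=> Uo; elim: k f g => [|k IH] f g.
  by move=> fU gU x Ux; apply: cvgD; [exact: fU|exact: gU].
move=> [fU DfU] [gU DgU]; split=> [x Ux|v].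
  by apply: differentiableD; [exact: fU|exact: gU].
apply: eq_Ck (IH _ _ (DfU v) (DgU v)) => // x Ux.
by rewrite deriveD//; apply: diff_derivable; [exact: fU|exact: gU].
Qed.

Lemma Ck_sum V W k (U : set V) (I : Type) (r : seq I) (P : pred I)
    (F : I -> V -> W) : open U ->
  (forall i, P i -> Ck k U (F i)) -> Ck k U (fun x => \sum_(i <- r | P i) F i x).
Proof.
move=> Uo FP; elim: r => [|i r IH].
  by rewrite (_ : (fun x => _) = fun=> 0);
    [exact: Ck_cst|apply/funext => x; rewrite big_nil].
have [Pi|Pi] := boolP (P i); last first.
  by under eq_fun do rewrite big_cons (negbTE Pi).
under eq_fun do rewrite big_cons Pi.
by apply: CkD => //; exact: FP.
Qed.

Lemma Ck_linear V W X k (U : set V) (L : {linear W -> X}) (f : V -> W) :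
  open U -> continuous L -> Ck k U f -> Ck k U (fun x => L (f x)).
Proof.
move=> Uo Lc; elim: k f => [|k IH] f.
  by move=> fU x Ux; apply: (continuous_comp (fU x Ux)); exact: Lc.
move=> [fU DfU]; have Ld y : differentiable L y by exact: linear_differentiable.
split=> [x Ux|v]; first exact: (differentiable_comp (fU x Ux)).
apply: eq_Ck (IH _ (DfU v)) => // x Ux.
rewrite deriveE; last exact: fU.
rewrite deriveE; last exact: (differentiable_comp (fU x Ux)).
by rewrite (diff_comp (fU x Ux) (Ld _)) diff_lin.
Qed.

Lemma CkN V W k (U : set V) (f : V -> W) : open U ->
  Ck k U f -> Ck k U (fun x => - f x).
Proof. by move=> Uo fU; apply: (Ck_linear (L := -%R)) => // x; exact: opp_continuous. Qed.

Lemma CkM V k (U : set V) (f g : V -> R) : open U ->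
  Ck k U f -> Ck k U g -> Ck k U (fun x => f x * g x).
Proof.
move=> Uo; elim: k f g => [|k IH] f g.
  by move=> fU gU x Ux; apply: cvgM; [exact: fU|exact: gU].
move=> fk gk; have [[fU DfU] [gU DgU]] := (fk, gk); split=> [x Ux|v].
  by apply: differentiableM; [exact: fU|exact: gU].
apply: eq_Ck (CkD Uo (IH _ _ (CkS fk) (DgU v)) (IH _ _ (CkS gk) (DfU v))) => // x Ux.
by rewrite deriveM//; apply: diff_derivable; [exact: fU|exact: gU].
Qed.

Lemma Ck_prod V k (U : set V) (I : Type) (r : seq I) (P : pred I)
    (F : I -> V -> R) : open U ->
  (forall i, P i -> Ck k U (F i)) -> Ck k U (fun x => \prod_(i <- r | P i) F i x).
Proof.
move=> Uo FP; elim: r => [|i r IH].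
  by rewrite (_ : (fun x => _) = fun=> 1);
    [exact: Ck_cst|apply/funext => x; rewrite big_nil].
have [Pi|Pi] := boolP (P i); last first.
  by under eq_fun do rewrite big_cons (negbTE Pi).
under eq_fun do rewrite big_cons Pi.
by apply: CkM => //; exact: FP.
Qed.

Lemma CkV V k (U : set V) (f : V -> R) : open U -> (forall x, U x -> f x != 0) ->
  Ck k U f -> Ck k U (fun x => (f x)^-1).
Proof.
move=> Uo f0; elim: k => [|k IH] fk.
  by move=> x Ux; apply: cvgV; [exact: f0|exact: fk].
have [fU DfU] := fk; split=> [x Ux|v].
  by apply: differentiableV; [exact: fU|exact: f0].
have fVk := IH (CkS fk).
apply: eq_Ck (CkM Uo (CkN Uo (CkM Uo fVk fVk)) (DfU v)) => // x Ux.
rewrite deriveV; last 2 first.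
- exact: f0.
- exact/diff_derivable/fU.
by rewrite expr2 invfM.
Qed.

(** [Ck] controls derivatives in fixed directions, while the chain rule produces the moving
    direction ['D_v g x]. The finite basis [e], with coordinate forms [l], rewrites the derivative
    as a sum of products of functions of class [k]. *)
Lemma Ck_comp V X k (I : finType) (e : I -> X) (l : I -> {linear X -> R})
    (U : set V) (U' : set X) (f : X -> R) (g : V -> X) :
  open U -> open U' -> (forall i, continuous (l i)) ->
  (forall y, y = \sum_i l i y *: e i) -> (forall x, U x -> U' (g x)) ->
  Ck k U' f -> Ck k U g -> Ck k U (fun x => f (g x)).
Proof.
move=> Uo U'o lc le gU'; elim: k f => [|k IH] f.
  move=> fU gU x Ux; apply: (continuous_comp (gU x Ux)); apply: fU; exact: gU'.
move=> [fU DfU] gk; have [gU DgU] := gk.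
have dfg x : U x -> differentiable (fun x => f (g x)) x.
  by move=> Ux; apply: (differentiable_comp (gU x Ux)); apply: fU; exact: gU'.
split=> // v.
have H : Ck k U (fun x => \sum_i l i ('D_v g x) * 'D_(e i) f (g x)).
  apply: Ck_sum => // i _; apply: CkM => //; first exact: (Ck_linear (L := l i) Uo (lc i) (DgU v)).
  exact: (IH ('D_(e i) f) (DfU (e i)) (CkS gk)).
apply: eq_Ck H => // x Ux.
have fx := fU _ (gU' _ Ux).
rewrite [RHS]deriveE; last exact: dfg.
rewrite (diff_comp (gU x Ux) fx) /= -(@deriveE _ _ _ g x v (gU x Ux)).
rewrite [in RHS](le ('D_v g x)) linear_sum.
by apply: eq_bigr => i _; rewrite linearZ (deriveE (e i) fx).
Qed.

End CkGeneral.

(** * Functions with values in matrices and in pairs *)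

Section CkMatrix.
Context {R : realType} {V : normedModType R}.
Implicit Types (U : set V) (k : nat).

Definition mxcoord m n (i : 'I_m) (j : 'I_n) (A : 'M[R]_(m, n)) : R := A i j.

Fact mxcoord_is_linear m n (i : 'I_m) (j : 'I_n) : linear (@mxcoord m n i j).
Proof. by move=> a A B; rewrite /mxcoord !mxE. Qed.
HB.instance Definition _ m n i j :=
  GRing.isLinear.Build R 'M[R]_(m, n) R _ (@mxcoord m n i j) (@mxcoord_is_linear m n i j).

Lemma mxcoord_continuous m n (i : 'I_m) (j : 'I_n) : continuous (@mxcoord m n i j).
Proof. exact: coord_continuous. Qed.

Definition scalev (W : normedModType R) (w : W) (a : R) : W := a *: w.

Fact scalev_is_linear (W : normedModType R) (w : W) : linear (scalev w).
Proof. by move=> a x y; rewrite /scalev scalerDl scalerA. Qed.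
HB.instance Definition _ (W : normedModType R) (w : W) :=
  GRing.isLinear.Build R R W _ (scalev w) (scalev_is_linear w).

Definition injl (W X : normedModType R) (w : W) : W * X := (w, 0).
Definition injr (W X : normedModType R) (z : X) : W * X := (0, z).

Fact injl_is_linear (W X : normedModType R) : linear (@injl W X).
Proof.
by move=> a x y; apply: injective_projections => /=; rewrite ?scaler0 ?addr0.
Qed.
HB.instance Definition _ (W X : normedModType R) :=
  GRing.isLinear.Build R W (W * X)%type _ (@injl W X) (@injl_is_linear W X).

Fact injr_is_linear (W X : normedModType R) : linear (@injr W X).
Proof.
by move=> a x y; apply: injective_projections => /=; rewrite ?scaler0 ?addr0.
Qed.
HB.instance Definition _ (W X : normedModType R) :=
  GRing.isLinear.Build R X (W * X)%type _ (@injr W X) (@injr_is_linear W X).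

Lemma Ck_mxP k U m n (A : V -> 'M[R]_(m, n)) : open U ->
  Ck k U A <-> forall i j, Ck k U (fun x => A x i j).
Proof.
move=> Uo; split=> [Ak i j|Ak].
  exact: (Ck_linear (L := mxcoord i j) Uo (@mxcoord_continuous _ _ i j) Ak).
have -> : A = fun x => \sum_i \sum_j scalev (delta_mx i j) (A x i j).
  by apply/funext => x; exact: matrix_sum_delta.
apply: Ck_sum => // i _; apply: Ck_sum => // j _.
apply: (Ck_linear (L := scalev (delta_mx i j)) Uo _ (Ak i j)).
exact: scalel_continuous.
Qed.

Lemma Ck_mulmx k U m n p (A : V -> 'M[R]_(m, n)) (B : V -> 'M[R]_(n, p)) :
  open U -> Ck k U A -> Ck k U B -> Ck k U (fun x => A x *m B x).
Proof.
move=> Uo /Ck_mxP Ak /Ck_mxP Bk; apply/Ck_mxP => // i j.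
under eq_fun do rewrite mxE.
by apply: Ck_sum => // l _; apply: CkM => //; [exact: Ak|exact: Bk].
Qed.

Lemma Ck_trmx k U m n (A : V -> 'M[R]_(m, n)) :
  open U -> Ck k U A -> Ck k U (fun x => (A x)^T).
Proof.
move=> Uo /Ck_mxP Ak; apply/Ck_mxP => // i j.
by under eq_fun do rewrite mxE; exact: Ak.
Qed.

Lemma Ck_scalemx k U m n (a : V -> R) (A : V -> 'M[R]_(m, n)) :
  open U -> Ck k U a -> Ck k U A -> Ck k U (fun x => a x *: A x).
Proof.
move=> Uo ak /Ck_mxP Ak; apply/Ck_mxP => // i j.
by under eq_fun do rewrite mxE; apply: CkM => //; exact: Ak.
Qed.

Lemma Ck_det k U n (A : V -> 'M[R]_n) :
  open U -> Ck k U A -> Ck k U (fun x => \det (A x)).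
Proof.
move=> Uo /Ck_mxP Ak; rewrite /determinant; apply: Ck_sum => // s _.
apply: CkM => //; first exact: Ck_cst.
by apply: Ck_prod => // i _; exact: Ak.
Qed.

(** By the adjugate formula the entries of the inverse are polynomials in those of [A x], divided by
    the determinant. *)
Lemma Ck_invmx k U n (A : V -> 'M[R]_n) :
  open U -> (forall x, U x -> A x \in unitmx) ->
  Ck k U A -> Ck k U (fun x => invmx (A x)).
Proof.
move=> Uo Au Ak; have detk := Ck_det Uo Ak; move/Ck_mxP : Ak => Ak.
have : Ck k U (fun x => (\det (A x))^-1 *: \adj (A x)).
  apply: Ck_scalemx => //.
    by apply: CkV => // x /Au; rewrite unitmxE unitfE.
  apply/Ck_mxP => // i j; under eq_fun do rewrite mxE.
  apply: CkM => //; first exact: Ck_cst.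
  apply: Ck_det => //; apply/Ck_mxP => // a b.
  by under eq_fun do rewrite !mxE; exact: Ak.
by apply: eq_Ck => // x /Au Ax; rewrite /invmx Ax.
Qed.

Lemma Ck_pairP (W X : normedModType R) k U (f : V -> W * X) : open U ->
  Ck k U f <-> Ck k U (fun x => (f x).1) /\ Ck k U (fun x => (f x).2).
Proof.
move=> Uo; split=> [fk|[f1 f2]].
  split; [apply: (Ck_linear (L := fst) Uo _ fk)|apply: (Ck_linear (L := snd) Uo _ fk)].
    by move=> x; exact: cvg_fst.
  by move=> x; exact: cvg_snd.
have -> : f = fun x => @injl W X (f x).1 + @injr W X (f x).2.
  by apply/funext => x; rewrite /injl /injr; case: (f x) => a b;
     congr (_, _); rewrite /= ?addr0 ?add0r.
apply: CkD => //.
  apply: (Ck_linear (L := @injl W X) Uo _ f1) => x.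
  by apply: cvg_pair; [exact: cvg_id|exact: cvg_cst].
apply: (Ck_linear (L := @injr W X) Uo _ f2) => x.
by apply: cvg_pair; [exact: cvg_cst|exact: cvg_id].
Qed.

Lemma Ck_comp_rV k n U (U' : set 'rV[R]_n) (f : 'rV[R]_n -> R) (g : V -> 'rV[R]_n) :
  open U -> open U' -> (forall x, U x -> U' (g x)) ->
  Ck k U' f -> Ck k U g -> Ck k U (fun x => f (g x)).
Proof.
move=> Uo U'o; apply: (@Ck_comp _ _ _ _ _ (delta_mx 0) (fun i => mxcoord 0 i)) => //.
  by move=> i; exact: mxcoord_continuous.
exact: row_sum_delta.
Qed.

Lemma Ck_comp_R k U (U' : set R) (f : R -> R) (g : V -> R) :
  open U -> open U' -> (forall x, U x -> U' (g x)) ->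
  Ck k U' f -> Ck k U g -> Ck k U (fun x => f (g x)).
Proof.
move=> Uo U'o; apply: (@Ck_comp R V R k 'I_1 (fun=> 1) (fun=> idfun) U U' f g) => //.
  by move=> _ x; exact: cvg_id.
by move=> y; rewrite big_ord1 /= [RHS]mulr1.
Qed.

End CkMatrix.

(** * Smoothness of the square root *)

Section Sylvester.
Context {R : realType} {n : nat}.

Definition sylvester (S T D : 'M[R]_n) : 'M[R]_n := S *m D + D *m T.

Fact sylvester_is_linear S T : linear (sylvester S T).
Proof.
move=> a A B; rewrite /sylvester mulmxDr mulmxDl -scalemxAr -scalemxAl scalerDr.
by rewrite addrACA.
Qed.
HB.instance Definition _ S T :=
  GRing.isLinear.Build R 'M[R]_n 'M[R]_n _ (sylvester S T) (sylvester_is_linear S T).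

(** Vectorising the Sylvester operator makes its inverse an [invmx], whose dependence on [S] and [T]
    is then controlled by [Ck_invmx]. *)
Definition sylvester_mx S T : 'M[R]_(n * n) := lin_mx (sylvester S T).

Lemma sylvester_mx_unit S T : posdef S -> posdef T -> sylvester_mx S T \in unitmx.
Proof.
move=> Sp Tp; rewrite -row_free_unit; apply: inj_row_free => v.
rewrite -[v]vec_mxK mul_vec_lin => /(congr1 vec_mx); rewrite mxvecK linear0.
by move/(sylvester_inj Sp Tp) => ->; rewrite linear0.
Qed.

Lemma sylvester_mxK S T D : posdef S -> posdef T ->
  vec_mx (mxvec (sylvester S T D) *m invmx (sylvester_mx S T)) = D.
Proof.
move=> Sp Tp; rewrite -mul_vec_lin mulmxK ?mxvecK//.
exact: sylvester_mx_unit.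
Qed.

Lemma Ck_sylvester_mx (V : normedModType R) k (U : set V) (S T : V -> 'M[R]_n) :
  open U -> Ck k U S -> Ck k U T -> Ck k U (fun x => sylvester_mx (S x) (T x)).
Proof.
move=> Uo Sk Tk; apply/Ck_mxP => // i j; case/mxvec_indexP: j => a b.
under eq_fun do rewrite mxE /= mxvecE.
have : Ck k U (fun x => sylvester (S x) (T x) (vec_mx (delta_mx 0 i))).
  by apply: CkD => //; apply: Ck_mulmx => //; exact: Ck_cst.
by move/Ck_mxP; exact.
Qed.

End Sylvester.

Section SqrtSmooth.
Context {R : realType} {V : normedModType R}.

(** In [f g = g(x) f + f (g - g(x))] the last term is [o(h)], since [f] is [O(h)] and [g] is
    continuous. This gives differentiability of the root at a stage where the inverse Sylvester
    matrix is known only to be continuous. *)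
Lemma differentiable_mul_vanish (f g : V -> R) x :
  differentiable f x -> f x = 0 -> {for x, continuous g} ->
  differentiable (fun y => f y * g y) x.
Proof.
move=> fd f0 gc.
have -> : (fun y => f y * g y) = (fun y => g x *: f y + f y * (g y - g x)).
  by apply/funext => y; rewrite -[_ *: _]/(_ * _); ring.
apply: differentiableD; first exact: differentiableZ.
suff [] : is_diff x (fun y => f y * (g y - g x)) (\0 : {linear V -> R}) by [].
apply: is_diff_epsP => [y|e e0]; first exact: cvg_cst.
have [dfc /eqaddoP fE] := (diff_locallyP _ _).1 fd.
have [K K0 dfK] := linear_lipschitz dfc.
(* In the bound for [f (h + x)], [K] accounts for the differential and 1 for the remainder. *)
have K1 : 0 < K + 1 by rewrite addr_gt0.
have {}fE := fE 1 ltr01.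
have : \forall h \near 0, `|g x - g (h + x)| < e / (K + 1).
  have /cvgrPdist_lt/(_ (e / (K + 1)) (divr_gt0 e0 K1))/nbhs0P := gc.
  by apply: filterS => h /=; rewrite (addrC h).
move=> gE; near=> h.
rewrite f0 mul0r /= !subr0 normrM.
have fh : `|f (h + x)| <= (K + 1) * `|h|.
  have : `|f (h + x) - 'd f x h| <= `|h|.
    have : `|(f \o shift x - (cst (f x) + 'd f x)) h| <= 1 * `|h| by near: h.
    by rewrite -[X in `|X|]/(f (h + x) - (f x + 'd f x h)) f0 add0r mul1r.
  have := dfK h; rewrite mulrDl mul1r => h1 h2.
  rewrite -(subrK ('d f x h) (f (h + x))) (le_trans (ler_normD _ _))//.
  by rewrite addrC lerD.
have gh : `|g (h + x) - g x| <= e / (K + 1).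
  by rewrite distrC ltW//; near: h.
rewrite (le_trans (ler_pM _ _ fh gh))//.
have eK : e / (K + 1) * (K + 1) = e by rewrite divfK// gt_eqF.
by rewrite -[X in _ <= X * _]eK [leLHS]mulrC mulrA.
Unshelve. all: by end_near. Qed.

Lemma derive_mulmx m n p (A : V -> 'M[R]_(m, n)) (B : V -> 'M[R]_(n, p)) x v :
  differentiable A x -> differentiable B x ->
  'D_v (fun y => A y *m B y) x = 'D_v A x *m B x + A x *m 'D_v B x.
Proof.
move=> Ad Bd.
have Av : derivable A x v by exact: diff_derivable.
have Bv : derivable B x v by exact: diff_derivable.
have Aij := (derivable_mxP _ _ _).1 Av; have Bij := (derivable_mxP _ _ _).1 Bv.
have ABE i j : (fun y => (A y *m B y) i j) =
    \sum_(l < n) ((fun y => A y i l) * (fun y => B y l j)).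
  by apply/funext => y; rewrite mxE fct_sumE.
have ABij i j : derivable (fun y => (A y *m B y) i j) x v.
  by rewrite ABE; apply: derivable_sum => l; exact: derivableM.
rewrite derive_mx; last by apply/derivable_mxP.
rewrite (derive_mx Av) (derive_mx Bv).
apply/matrixP => i j; rewrite !mxE ABE derive_sum => [|l]; last exact: derivableM.
rewrite -big_split /=; apply: eq_bigr => l _.
by rewrite deriveM// !mxE addrC; congr (_ + _); rewrite mulrC.
Qed.

Lemma differentiable_mxP m n (A : V -> 'M[R]_(m, n)) x :
  (forall i j, differentiable (fun y => A y i j) x) -> differentiable A x.
Proof.
move=> Ad.
have -> : A = \sum_i \sum_j (fun y => A y i j *: delta_mx i j).
  by apply/funext => y; rewrite [LHS]matrix_sum_delta !fct_sumE;
    apply: eq_bigr => i _; rewrite fct_sumE.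
apply: differentiable_sum => i; apply: differentiable_sum => j.
exact: differentiableZl.
Qed.

Variables (n : nat) (U : set V) (B : V -> 'M[R]_n).
Hypothesis Uo : open U.
Hypothesis Bp : forall x, U x -> posdef (B x).

Let S x := mxsqrt (B x).
Let Sp x : U x -> posdef (S x). Proof. by move=> /Bp/mxsqrtP[]. Qed.
Let SE x : U x -> S x *m S x = B x. Proof. by move=> /Bp/mxsqrtP[]. Qed.

Let sylvester_diff x y : U x -> U y ->
  sylvester (S y) (S x) (S y - S x) = B y - B x.
Proof.
move=> Ux Uy; rewrite /sylvester mulmxBr mulmxBl !SE//.
by rewrite subrKA.
Qed.

Let sqrt_continuous : Ck 0 U B -> Ck 0 U S.
Proof.
move=> B0; apply/(Ck_mxP 0 _ Uo) => i j x Ux.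
(* [c] is attached to the fixed root [S x], so it serves every [y]; [phi y] then bounds the squared
   entries of [S y - S x] up to the factor [c]. *)
have [c c0 cS] := sylvester_lower_bound (Sp Ux).
pose phi y := \tr ((B y - B x) *m (B y - B x)^T).
have phi0 : Ck 0 U phi.
  apply: Ck_sum => // a _.
  have D0 : Ck 0 U (fun y => B y - B x) by exact: CkD Uo B0 (Ck_cst _ _ (- B x)).
  by have /(Ck_mxP _ _ Uo) := Ck_mulmx Uo D0 (Ck_trmx Uo D0); exact.
apply/cvgrPdist_lt => e e0.
have ce0 : 0 < c * e ^+ 2 by rewrite mulr_gt0// exprn_gt0.
have /cvgrPdist_lt/(_ _ ce0) := phi0 x Ux.
have -> : phi x = 0 by rewrite /phi subrr mul0mx mxtrace0.
move=> phiE; near=> y.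
have Uy : U y by near: y; exact: open_nbhs_nbhs.
have : `|0 - phi y| < c * e ^+ 2 by near: y.
rewrite sub0r normrN ger0_norm ?mxtrace_tr_ge0// => phiy.
have := cS (S y) (S y - S x) (Sp Uy).
rewrite -/(sylvester _ _ _) sylvester_diff// -/(phi y) => /le_lt_trans/(_ phiy).
rewrite ltr_pM2l// => /(le_lt_trans (sqr_le_mxtrace _ i j)).
by rewrite !mxE distrC -real_normK ?num_real// ltr_pXn2r// ?nnegrE// ltW.
Unshelve. all: by end_near. Qed.

Let sqrt_differentiable x : U x -> Ck 0 U B -> differentiable B x -> differentiable S x.
Proof.
move=> Ux B0 Bd.
pose N y := invmx (sylvester_mx (S y) (S x)).
have N0 : Ck 0 U N.
  apply: Ck_invmx => // [y Uy|]; first by apply: sylvester_mx_unit; exact: Sp.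
  by apply: Ck_sylvester_mx => //; [exact: sqrt_continuous|exact: Ck_cst].
(* On [U] this expression equals [S y], by solving the equation of [sylvester_diff]. The factor
   [B y - B x] vanishes at [x], so continuity of [N] is enough. *)
have : differentiable (fun y => S x + vec_mx (mxvec (B y - B x) *m N y)) x.
  apply: differentiableD; first exact: differentiable_cst.
  apply: differentiable_mxP => i j.
  have -> : (fun y => vec_mx (mxvec (B y - B x) *m N y) i j) =
     \sum_k (fun y => mxvec (B y - B x) 0 k * N y k (mxvec_index i j)).
    by apply/funext => y; rewrite !mxE fct_sumE.
  apply: differentiable_sum => k; case/mxvec_indexP: k => a b.
  apply: differentiable_mul_vanish.
  - under eq_fun do rewrite mxvecE.
    have BxBd : differentiable (fun y => B y - B x) x.
      by apply: differentiableB => //; exact: differentiable_cst.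
    exact: (differentiable_comp BxBd (differentiable_coord _ a b)).
  - by rewrite subrr linear0 mxE.
  - by have /(Ck_mxP _ _ Uo) := N0; exact.
apply: near_eq_differentiable; near=> y.
have Uy : U y by near: y; exact: open_nbhs_nbhs.
by rewrite -sylvester_diff// sylvester_mxK; [rewrite addrC subrK|exact: Sp|exact: Sp].
Unshelve. all: by end_near. Qed.

Lemma Ck_mxsqrt k : Ck k U B -> Ck k U (fun x => mxsqrt (B x)).
Proof.
rewrite -/S; elim: k => [|k IH] Bk; first exact: sqrt_continuous.
have Sk := IH (CkS Bk); have [Bd DB] := Bk.
have B0 : Ck 0 U B by move=> x Ux; exact: Ck_continuous Bk Ux.
have Sd x : U x -> differentiable S x.
  by move=> Ux; apply: sqrt_differentiable => //; exact: Bd.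
split=> // v.
(* Differentiating [S S = B] gives a Sylvester equation for ['D_v S] with both coefficients [S x].
   Its solution formula is of class [k] because [S] is, by induction. *)
have : Ck k U (fun x => vec_mx (mxvec ('D_v B x) *m invmx (sylvester_mx (S x) (S x)))).
  have /(Ck_mxP _ _ Uo) Hk : Ck k U (fun x => mxvec ('D_v B x) *m invmx (sylvester_mx (S x) (S x))).
    apply: Ck_mulmx => //.
      apply/(Ck_mxP _ _ Uo) => i j; rewrite ord1; case/mxvec_indexP: j => a b.
      by under eq_fun do rewrite mxvecE; have /(Ck_mxP _ _ Uo) := DB v; exact.
    apply: Ck_invmx => // [x Ux|]; first by apply: sylvester_mx_unit; exact: Sp.
    exact: Ck_sylvester_mx.
  by apply/(Ck_mxP _ _ Uo) => i j; under eq_fun do rewrite mxE; exact: Hk.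
apply: eq_Ck => // x Ux.
have -> : 'D_v B x = sylvester (S x) (S x) ('D_v S x).
  rewrite /sylvester addrC -derive_mulmx//; try exact: Sd.
  by apply: near_eq_derive; apply: eq_near_open Ux _ => // y Uy; rewrite SE.
by rewrite sylvester_mxK//; exact: Sp.
Qed.

End SqrtSmooth.

Section GmeanSmooth.
Context {R : realType} {V : normedModType R} {n : nat} (U : set V).
Hypothesis Uo : open U.

Lemma Ck_gmean k (G B : V -> 'M[R]_n) :
  (forall x, U x -> posdef (G x)) -> (forall x, U x -> posdef (B x)) ->
  Ck k U G -> Ck k U B -> Ck k U (fun x => gmean (G x) (B x)).
Proof.
move=> Gp Bp Gk Bk; have Hk := Ck_mxsqrt Uo Gp Gk.
have HVk : Ck k U (fun x => invmx (mxsqrt (G x))).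
  by apply: Ck_invmx => // x /Gp/mxsqrtP[/posdef_unitmx].
rewrite /gmean; do 2?[apply: Ck_mulmx => //].
apply: Ck_mxsqrt => // [x Ux|]; last by do 2?[apply: Ck_mulmx => //].
by apply: gmean_arg_posdef; [exact: Gp|exact: Bp].
Qed.

Lemma Ck_compat_acs k (G W : V -> 'M[R]_n) :
  (forall x, U x -> posdef (G x)) -> (forall x, U x -> W x \in unitmx) ->
  Ck k U G -> Ck k U W -> Ck k U (fun x => compat_acs (G x) (W x)).
Proof.
move=> Gp Wu Gk Wk; rewrite /compat_acs; apply: Ck_trmx => //.
apply: Ck_mulmx => //; first exact: Ck_invmx.
apply: Ck_gmean => // [x Ux|].
  by apply: posdef_congr; [exact: Wu|apply: posdef_inv; exact: Gp].
apply: Ck_mulmx => //; last exact: Ck_trmx.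
by apply: Ck_mulmx => //; apply: Ck_invmx => // x /Gp/posdef_unitmx.
Qed.

End GmeanSmooth.

(** * Bump functions *)

Section FlatExp.
Context {R : realType}.
Implicit Types (t : R) (k : nat).

(* The factor [t^-k] makes the family closed under differentiation. *)
Definition flat_exp k t : R := if t <= 0 then 0 else t^-1 ^+ k * expR (- t^-1).

Lemma flat_exp_le0 k t : t <= 0 -> flat_exp k t = 0.
Proof. by rewrite /flat_exp => ->. Qed.

Lemma flat_exp_gt0 k t : 0 < t -> 0 < flat_exp k t.
Proof.
by move=> t0; rewrite /flat_exp (leNgt t) t0/= mulr_gt0 ?expR_gt0// exprn_gt0 ?invr_gt0.
Qed.

Lemma flat_exp_ge0 k t : 0 <= flat_exp k t.
Proof. by have [/(flat_exp_le0 k) ->|/(flat_exp_gt0 k)/ltW] := leP t 0. Qed.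

(** With [s = t^-1], the exponential series gives [s^(k+2) / (k+2)! <= e^s], hence
    [s^k e^-s <= (k+2)! s^-2]. A quadratic bound makes the derivative at 0 exist and vanish. *)
Lemma flat_exp_bound k t : flat_exp k t <= k.+2`!%:R * t ^+ 2.
Proof.
have [t0|t0] := leP t 0; first by rewrite flat_exp_le0// mulr_ge0// sqr_ge0.
rewrite /flat_exp (leNgt t) t0/=.
have s0 : 0 < t^-1 by rewrite invr_gt0.
have := expR_ge1Dxn k.+1 (ltW s0); set s := t^-1 in s0 *; set F := k.+2`!%:R : R.
have F0 : 0 < F by rewrite ltr0n fact_gt0.
move=> h; have {h} : s ^+ k.+2 / F <= expR s by apply: le_trans h; rewrite lerDr.
rewrite ler_pdivrMr// expRN ler_pdivrMr ?expR_gt0// => h.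
have -> : t ^+ 2 = s ^- 2 by rewrite exprVn invrK.
rewrite mulrAC ler_pdivlMr ?exprn_gt0// -exprD addn2.
by rewrite mulrC.
Qed.

Lemma flat_exp_derive k t :
  differentiable (flat_exp k) t /\
  'D_1 (flat_exp k) t = flat_exp k.+2 t - k%:R * flat_exp k.+1 t.
Proof.
have [t0|t0|->] := ltgtP t 0.
- rewrite !(@flat_exp_le0 _ t) ?ltW// mulr0 subr0.
  have ft : \near t, (cst 0 : R -> R) t = flat_exp k t.
    near=> u; rewrite flat_exp_le0//; apply/ltW; near: u; exact: lt_nbhsl.
  split; first by apply: near_eq_differentiable ft _; exact: differentiable_cst.
  by rewrite -(near_eq_derive _ ft) derive_cst.
- have t1 : t != 0 by rewrite gt_eqF.
  pose f u : R := u^-1 ^+ k * expR (- u^-1).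
  have ft : \near t, f t = flat_exp k t.
    near=> u; rewrite /flat_exp (leNgt u); have -> : 0 < u by near: u; exact: lt_nbhsr.
    by [].
  have di : is_derive t 1 (fun u : R => u^-1) (- t^-1 ^+ 2).
    apply: (is_derive_eq (is_deriveV t1 (is_derive_id t 1))).
    by rewrite /GRing.scale /= mulr1 exprVn.
  have df : is_derive t 1 f (flat_exp k.+2 t - k%:R * flat_exp k.+1 t).
    have de : is_derive t 1 (fun u => expR (- u^-1)) (t^-1 ^+ 2 * expR (- t^-1)).
      have dn : is_derive t 1 (fun u : R => - u^-1) (t^-1 ^+ 2).
        by apply: (is_derive_eq (is_deriveN di)); rewrite opprK.
      apply: (is_derive_eq (is_derive1_comp (is_derive_expR _) dn)).
      by rewrite mulrC.
    have dX : is_derive t 1 (fun u : R => u^-1 ^+ k) (- k%:R * t^-1 ^+ k.+1).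
      have := is_deriveX k di; rewrite exprfctE => /is_derive_eq; apply.
      rewrite /GRing.scale /=.
      case: k {f ft} => [|k]; first by rewrite !mulr0n oppr0 !mul0r.
      rewrite /= !exprS; ring.
    apply: (is_derive_eq (is_deriveM dX de)).
    rewrite /flat_exp (leNgt t) t0/= /GRing.scale /= !exprS; ring.
  split; first by apply: near_eq_differentiable ft _; apply/derivable1_diffP; case: df.
  by rewrite -(near_eq_derive _ ft) derive_val.
rewrite !flat_exp_le0// mulr0 subr0.
have fb : forall e : R, 0 < e -> \forall h \near 0,
    `|flat_exp k (h + 0) - flat_exp k 0 - (\0 : {linear R -> R}) h| <= e * `|h|.
  move=> e e0; have F0 : 0 < k.+2`!%:R :> R by rewrite ltr0n fact_gt0.
  have eF0 : 0 < e / k.+2`!%:R by rewrite divr_gt0.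
  apply: filterS (nbhs0_le eF0) => h he.
  rewrite addr0 (@flat_exp_le0 k 0)// /= !subr0 ger0_norm ?flat_exp_ge0//.
  rewrite (le_trans (flat_exp_bound k h))// -real_normK ?num_real// expr2 mulrA.
  by rewrite ler_wpM2r// mulrC -ler_pdivlMr.
have fd : is_diff (0 : R) (flat_exp k) (\0 : {linear R -> R}).
  by apply: is_diff_epsP => // x; exact: cvg_cst.
by split; [exact: ex_diff|rewrite deriveE ?diff_val//; exact: ex_diff].
Unshelve. all: by end_near. Qed.

Lemma Ck_flat_exp l k (U : set R) : open U -> Ck l U (flat_exp k).
Proof.
move=> Uo; elim: l k => [|l IH] k.
  by move=> t _; apply: differentiable_continuous; case: (flat_exp_derive k t).
split=> [t _|v]; first by case: (flat_exp_derive k t).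
have H : Ck l U (fun t => v * (flat_exp k.+2 t - k%:R * flat_exp k.+1 t)).
  apply: CkM => //; first exact: Ck_cst.
  by apply: CkD => //; apply: CkN => //; apply: CkM => //; exact: Ck_cst.
apply: eq_Ck H => // t _; have [fd <-] := flat_exp_derive k t.
by rewrite !deriveE// -[v in RHS]mulr1 -[v * 1]/(v *: (1 : R)) linearZ.
Qed.

End FlatExp.

Section Bump.
Context {R : realType}.

(** A cutoff that is 1 up to [a] and 0 from [b] on. For [a < b] the two terms of the denominator are
    never both zero. *)
Definition smooth_step (a b t : R) : R :=
  flat_exp 0 (b - t) / (flat_exp 0 (b - t) + flat_exp 0 (t - a)).

Lemma smooth_step_den (a b t : R) : a < b ->
  0 < flat_exp 0 (b - t) + flat_exp 0 (t - a).
Proof.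
move=> ab; have [tb|bt] := ltP t b.
  by rewrite ltr_pwDl ?flat_exp_ge0// flat_exp_gt0// subr_gt0.
by rewrite ltr_wpDl ?flat_exp_ge0// flat_exp_gt0// subr_gt0 (lt_le_trans ab).
Qed.

Lemma smooth_step_ge0 (a b t : R) : a < b -> 0 <= smooth_step a b t.
Proof. by move=> ab; rewrite divr_ge0 ?flat_exp_ge0// ltW// smooth_step_den. Qed.

Lemma smooth_step_le1 (a b t : R) : a < b -> smooth_step a b t <= 1.
Proof.
by move=> ab; rewrite ler_pdivrMr ?smooth_step_den// mul1r lerDl flat_exp_ge0.
Qed.

Lemma smooth_step_eq1 (a b t : R) : a < b -> t <= a -> smooth_step a b t = 1.
Proof.
move=> ab ta; have := smooth_step_den t ab; rewrite /smooth_step.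
rewrite (@flat_exp_le0 _ _ (t - a)) ?subr_le0// addr0 => d0.
by rewrite divff// gt_eqF.
Qed.

Lemma smooth_step_eq0 (a b t : R) : b <= t -> smooth_step a b t = 0.
Proof. by move=> bt; rewrite /smooth_step flat_exp_le0 ?mul0r// subr_le0. Qed.

Lemma Ck_smooth_step (V : normedModType R) k (U : set V) (a b : R) (g : V -> R) :
  open U -> a < b -> Ck k U g -> Ck k U (fun x => smooth_step a b (g x)).
Proof.
move=> Uo ab gk.
have E0 f : Ck k U f -> Ck k U (fun x => flat_exp 0 (f x)).
  move=> fk; apply: (@Ck_comp_R _ _ _ _ setT) => //; first exact: openT.
  by apply: Ck_flat_exp; exact: openT.
have h1 : Ck k U (fun x => flat_exp 0 (b - g x)).
  by apply: E0; apply: CkD => //; [exact: Ck_cst|exact: CkN].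
have h2 : Ck k U (fun x => flat_exp 0 (g x - a)).
  by apply: E0; apply: CkD => //; exact: Ck_cst.
apply: CkM => //; apply: CkV => // [x _|]; last exact: CkD.
by rewrite gt_eqF// smooth_step_den.
Qed.

(** Squared coordinate differences avoid the absolute value, which is not smooth; the product over
    coordinates gives boxes, the balls of the max norm on row vectors. *)
Definition box_bump m (c : 'rV[R]_m) (r : R) (x : 'rV[R]_m) : R :=
  \prod_i smooth_step ((r / 2) ^+ 2) (r ^+ 2) ((x 0 i - c 0 i) ^+ 2).

Section Box.
Variables (m : nat) (c : 'rV[R]_m) (r : R).
Hypothesis r0 : 0 < r.

Let ab : (r / 2) ^+ 2 < r ^+ 2.
Proof.
have h : 0 < r / 2 by rewrite divr_gt0.
rewrite ltr_pXn2r// ?nnegrE; [move: r0; lra|exact: ltW|exact: ltW].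
Qed.

Lemma box_bump_ge0 (x : 'rV[R]_m) : 0 <= box_bump c r x.
Proof. by apply: prodr_ge0 => i _; exact: smooth_step_ge0. Qed.

Lemma box_bump_le1 (x : 'rV[R]_m) : box_bump c r x <= 1.
Proof. by apply: prodr_ile1 => i _; rewrite smooth_step_ge0 ?smooth_step_le1. Qed.

Lemma box_bump_eq1 (x : 'rV[R]_m) : (forall i, `|x 0 i - c 0 i| <= r / 2) -> box_bump c r x = 1.
Proof.
move=> xc; apply: big1 => i _; apply: smooth_step_eq1 => //.
by rewrite -real_normK ?num_real// ler_pXn2r ?nnegrE// divr_ge0// ltW.
Qed.

Lemma box_bump_eq0 (x : 'rV[R]_m) i : r <= `|x 0 i - c 0 i| -> box_bump c r x = 0.
Proof.
move=> xc; rewrite /box_bump (bigD1 i)//= smooth_step_eq0 ?mul0r//.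
by rewrite -[leRHS]real_normK ?num_real// ler_pXn2r ?nnegrE// ltW.
Qed.

Lemma Ck_box_bump k (U : set 'rV[R]_m) : open U -> Ck k U (box_bump c r).
Proof.
move=> Uo; apply: Ck_prod => // i _; apply: Ck_smooth_step => //.
have h : Ck k U (fun x : 'rV[R]_m => x 0 i - c 0 i).
  by apply: CkD; [|apply: (Ck_mxP _ _ Uo).1; exact: Ck_id|exact: Ck_cst].
by apply: eq_Ck (CkM Uo h h) => // x _; rewrite expr2.
Qed.

End Box.
End Bump.

(** * Charts *)

Lemma open_setI_preimage (T S : topologicalType) (f : T -> S) (A : set T) (B : set S) :
  open A -> (forall x, A x -> {for x, continuous f}) -> open B ->
  open (A `&` f @^-1` B).
Proof.
move=> Ao fc Bo; rewrite openE => x [Ax Bfx]; apply: filterI.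
  exact: open_nbhs_nbhs.
by apply: (fc x Ax); exact: open_nbhs_nbhs.
Qed.

(** A composite of two transition maps agrees with the third only near the point, the total
    functions being arbitrary elsewhere. *)
Lemma diff_comp_near (R : realType) (V W X : normedModType R)
    (f : V -> W) (g : W -> X) (h : V -> X) x v :
  differentiable f x -> differentiable g (f x) -> (\near x, h x = g (f x)) ->
  'd h x v = 'd g (f x) ('d f x v).
Proof.
move=> fd gd hE; have gfd := differentiable_comp fd gd.
have hd : differentiable h x.
  apply: near_eq_differentiable gfd.
  by apply: filterS hE => y ->.
rewrite -deriveE// (near_eq_derive _ hE) deriveE//.
by rewrite (diff_comp fd gd).
Qed.

Section Charts.
Context {R : realType} {m : nat} (M : smoothManifold R m).
Implicit Types (p q : M) (i j l : chart_index M) (x : 'rV[R]_m).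

Definition chart_cod i : set 'rV[R]_m := chart i @` chart_dom i.
Definition overlap i j : set 'rV[R]_m := chart i @` (chart_dom i `&` chart_dom j).

Lemma chart_invP i x : chart_cod i x ->
  chart_dom i (chart_inv i x) /\ chart i (chart_inv i x) = x.
Proof. by move=> [p ip <-]; rewrite chartK. Qed.

Lemma overlapE i j : overlap i j = chart_cod i `&` chart_inv i @^-1` chart_dom j.
Proof.
apply/seteqP; split=> [x [p [ip jp] <-]|x [[p ip <-]]] /=.
  by split; [exists p|rewrite chartK].
by rewrite chartK// => jp; exists p.
Qed.

Lemma chart_cod_preimage_open i (A : set M) :
  open A -> open (chart_cod i `&` chart_inv i @^-1` A).
Proof.
move=> Ao; apply: open_setI_preimage => //; first exact: chart_cod_open.
exact: chart_inv_continuous.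
Qed.

Lemma overlap_open i j : open (overlap i j).
Proof. by rewrite overlapE; exact/chart_cod_preimage_open/chart_dom_open. Qed.

Lemma transition_Ck i j k : Ck k (overlap i j) (chart j \o chart_inv i).
Proof. exact: transition_smooth. Qed.

Lemma transition_differentiable i j p : chart_dom i p -> chart_dom j p ->
  differentiable (chart j \o chart_inv i) (chart i p).
Proof.
by move=> ip jp; have [+ _] := transition_Ck i j 1; apply; exists p.
Qed.

Lemma mul_jac i j p (v : 'rV[R]_m) :
  v *m jac i j p = 'd (chart j \o chart_inv i) (chart i p) v.
Proof. by rewrite jac.unlock /jacobian mul_rV_lin1. Qed.

Lemma jac_comp i j l p : chart_dom i p -> chart_dom j p -> chart_dom l p ->
  jac i j p *m jac j l p = jac i l p.
Proof.
move=> ip jp lp; apply/row_matrixP => a; rewrite !rowE mulmxA.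
rewrite [LHS]mul_jac [X in 'd _ _ X]mul_jac mul_jac.
have ijp : (chart j \o chart_inv i) (chart i p) = chart j p by rewrite /= chartK.
have := transition_differentiable jp lp; rewrite -ijp => djl.
apply: esym; apply: (diff_comp_near _ (transition_differentiable ip jp) djl).
apply: (@eq_near_open _ _ _ (overlap i j) (chart l \o chart_inv i)
  ((chart l \o chart_inv j) \o (chart j \o chart_inv i))).
- exact: overlap_open.
- by exists p.
- by move=> _ [q [iq jq] <-] /=; rewrite chartK// chartK.
Qed.

Lemma jacii i p : chart_dom i p -> jac i i p = 1%:M.
Proof.
move=> ip; apply/row_matrixP => a; rewrite !rowE mul_jac mulmx1.
rewrite -deriveE; last exact: transition_differentiable.
rewrite -[RHS](derive_id (chart i p)); apply: near_eq_derive.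
apply: (@eq_near_open _ _ _ (chart_cod i) (chart i \o chart_inv i) id).
- exact: chart_cod_open.
- by exists p.
- by move=> _ [q iq <-] /=; rewrite chartK.
Qed.

Lemma jacK i j p : chart_dom i p -> chart_dom j p ->
  jac i j p *m jac j i p = 1%:M.
Proof. by move=> ip jp; rewrite jac_comp ?jacii. Qed.

Lemma jac_unit i j p : chart_dom i p -> chart_dom j p -> jac i j p \in unitmx.
Proof. by move=> ip jp; have [] := mulmx1_unit (jacK ip jp). Qed.

Lemma invmx_jac i j p : chart_dom i p -> chart_dom j p ->
  invmx (jac i j p) = jac j i p.
Proof.
move=> ip jp; have iju := jac_unit ip jp.
by apply: (can_inj (mulKmx iju)); rewrite mulmxV// jacK.
Qed.

Lemma chart_atP p : chart_dom (chart_at p) p.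
Proof. exact: svalP (cid (chart_dom_cover p)). Qed.

Lemma Ck_jac i j k : Ck k (overlap i j) (fun x => jac i j (chart_inv i x)).
Proof.
have Uo := @overlap_open i j; have [_ Dk] := transition_Ck i j k.+1.
suff : Ck k (overlap i j)
    (fun x => \matrix_(a, b) 'D_(delta_mx 0 a) (chart j \o chart_inv i) x 0 b).
  apply: eq_Ck => // _ [p [ip jp] <-]; apply/row_matrixP => a.
  rewrite [RHS]rowE mul_jac chartK// -deriveE; last exact: transition_differentiable.
  by apply/rowP => b; rewrite !mxE.
apply/(Ck_mxP _ _ Uo) => a b; under eq_fun do rewrite mxE.
by have /(Ck_mxP _ _ Uo) := Dk (delta_mx 0 a); exact.
Qed.

(** The components in chart [i] of the covariant 2-tensor whose matrix in the frame of [chart_at p]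
    is [h p]. *)
Definition tensor_coord i (h : M -> 'M[R]_m) p : 'M[R]_m :=
  jac i (chart_at p) p *m h p *m (jac i (chart_at p) p)^T.

Definition smooth_tensor (h : M -> 'M[R]_m) : Prop :=
  forall i, smooth_on (chart_cod i) (fun x => tensor_coord i h (chart_inv i x)).

Definition smooth_function (f : M -> R) : Prop :=
  forall i, smooth_on (chart_cod i) (fun x => f (chart_inv i x)).

Lemma tensor_coord_posdef i h p :
  chart_dom i p -> posdef (h p) -> posdef (tensor_coord i h p).
Proof. by move=> ip; apply: posdef_congr; apply: jac_unit => //; exact: chart_atP. Qed.

End Charts.

(** * Riemannian metrics *)

Section Metric.
Context {R : realType} {m : nat} (M : smoothManifold R m).
Implicit Types (p q : M) (i j l : chart_index M) (x : 'rV[R]_m).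

(** The chart is not recorded, so that pieces from different charts can form one sequence.
    Definiteness wherever [f] is positive, and not only on [V], is what positivity of the glued sum
    uses. *)
Definition local_metric (f : M -> R) (V : set M) (h : M -> 'M[R]_m) : Prop :=
  [/\ smooth_function f /\ smooth_tensor h,
      forall q, 0 <= f q <= 1,
      open V /\ (forall q, V q -> f q = 1),
      forall q, possemidef (h q) &
      forall q, 0 < f q -> posdef (h q)].

Definition closed_box (c : 'rV[R]_m) (r : R) : set 'rV[R]_m :=
  [set x | forall a, (x 0 a \in `[c 0 a - r, c 0 a + r])].

Lemma closed_box_compact c r : compact (closed_box c r).
Proof.
apply: (@rV_compact R m (fun a => [set` `[c 0 a - r, c 0 a + r]])) => a.
exact: segment_compact.
Qed.

Section Local.
Variables (i : chart_index M) (c : 'rV[R]_m) (r : R).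
Hypothesis r0 : 0 < r.
Hypothesis boxi : closed_box c r `<=` chart_cod i.

Let K : set M := chart_inv i @` closed_box c r.

(** Compact sets are closed in a Hausdorff space; this is what makes extension by zero smooth
    outside the chart domain. *)
Let K_closed : closed K.
Proof.
apply: compact_closed; first exact: manifold_hausdorff.
apply: continuous_compact; last exact: closed_box_compact.
apply: continuous_in_subspaceT => x; rewrite inE => /boxi.
exact: chart_inv_continuous.
Qed.

Definition chart_bump (q : M) : R :=
  if q \in chart_dom i then box_bump c r (chart i q) else 0.

(** The Euclidean metric of chart [i] in the frame of [chart_at q], weighted by the bump; off the
    chart domain the Jacobian is meaningless and the weight is 0. *)
Definition chart_metric (q : M) : 'M[R]_m :=
  chart_bump q *: (jac (chart_at q) i q *m (jac (chart_at q) i q)^T).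

Lemma chart_bump_in q : chart_dom i q -> chart_bump q = box_bump c r (chart i q).
Proof. by rewrite /chart_bump => /mem_set ->. Qed.

Lemma chart_bump_ge0 q : 0 <= chart_bump q.
Proof. by rewrite /chart_bump; case: ifP => // _; exact: box_bump_ge0. Qed.

Lemma chart_bump_gt0 q : 0 < chart_bump q -> chart_dom i q.
Proof. by rewrite /chart_bump; case: ifPn => [/set_mem//|]; rewrite ltxx. Qed.

Let chart_bump_notK q : ~ K q -> chart_bump q = 0.
Proof.
move=> nKq; rewrite /chart_bump; case: ifPn => // /set_mem iq.
have [/forallP qb|] := boolP [forall a, chart i q 0 a \in `[c 0 a - r, c 0 a + r]].
  by case: nKq; exists (chart i q) => //; rewrite chartK.
rewrite negb_forall => /existsP[a qa]; apply: (@box_bump_eq0 _ _ _ _ r0 _ a).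
rewrite leNgt; apply: contra qa => qa; rewrite in_itv /=.
by move: qa; rewrite ltr_norml; lra.
Qed.

(** [chart_dom i] and the complement of [K] are open and cover [M]; on the latter the bump vanishes,
    hence so does [F]. *)
Let Ck_local_chart (W : normedModType R) j k (F : M -> W) :
  (forall q, chart_bump q = 0 -> F q = 0) ->
  Ck k (overlap j i) (fun x => F (chart_inv j x)) ->
  Ck k (chart_cod j) (fun x => F (chart_inv j x)).
Proof.
move=> F0 Fk; apply: Ck_local => x xj; have [jq qx] := chart_invP xj.
have [iq|iq] := pselect (chart_dom i (chart_inv j x)).
  by exists (overlap j i) => //; exists (chart_inv j x).
have nKq : ~ K (chart_inv j x).
  by move=> [y /boxi yi yx]; apply: iq; rewrite -yx; case: (chart_invP yi).
have Vo : open (chart_cod j `&` chart_inv j @^-1` (~` K)).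
  by apply: chart_cod_preimage_open; exact: closed_openC K_closed.
exists (chart_cod j `&` chart_inv j @^-1` (~` K)) => //.
apply: eq_Ck Vo _ (Ck_cst _ _ (0 : W)) => y [_ nKy].
by rewrite F0// chart_bump_notK.
Qed.

Lemma chart_bump_smooth : smooth_function chart_bump.
Proof.
move=> j k; apply: Ck_local_chart => //.
have Uo := @overlap_open _ _ M j i.
have : Ck k (overlap j i) (fun x => box_bump c r ((chart i \o chart_inv j) x)).
  apply: (@Ck_comp_rV _ _ _ _ _ setT) => //; first exact: openT.
    by apply: Ck_box_bump => //; exact: openT.
  exact: transition_Ck.
apply: eq_Ck => // _ [q [jq iq] <-] /=.
by rewrite chartK// chart_bump_in.
Qed.

Lemma chart_metric_smooth : smooth_tensor chart_metric.
Proof.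
move=> j k; apply: Ck_local_chart => [q q0|].
  by rewrite /tensor_coord /chart_metric q0 scale0r mulmx0 mul0mx.
have Uo := @overlap_open _ _ M j i.
have Jk := Ck_jac j i k.
have bk : Ck k (overlap j i) (fun x => chart_bump (chart_inv j x)).
  apply: Ck_sub (chart_bump_smooth j k) => _ [q [jq _] <-].
  by exists q.
apply: eq_Ck (Ck_scalemx Uo bk (Ck_mulmx Uo Jk (Ck_trmx Uo Jk))) => //.
move=> _ [q [jq iq] <-]; rewrite chartK// /tensor_coord /chart_metric.
rewrite -scalemxAr -scalemxAl; congr (_ *: _).
rewrite -(jac_comp jq (chart_atP q) iq) trmx_mul !mulmxA.
by [].
Qed.

Lemma chart_metric_semi q : possemidef (chart_metric q).
Proof.
apply: possemidefZ; first exact: chart_bump_ge0.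
by rewrite -[X in X *m _]mulmx1; apply: possemidef_tr; exact/posdef_semi/posdef1.
Qed.

Lemma chart_metric_pos q : 0 < chart_bump q -> posdef (chart_metric q).
Proof.
move=> q0; have iq := chart_bump_gt0 q0; apply: posdefZ => //.
rewrite -[X in X *m _]mulmx1; apply: posdef_congr; last exact: posdef1.
by apply: jac_unit => //; exact: chart_atP.
Qed.

End Local.

Lemma local_metric_exists p : exists f V h, local_metric f V h /\ V p.
Proof.
pose i := chart_at p; pose c := chart i p.
have ci : chart_cod i c by exists p => //; exact: chart_atP.
have /nbhs_ballP[e /= e0 ei] : nbhs c (chart_cod i).
  by apply: open_nbhs_nbhs; split=> //; exact: chart_cod_open.
(* Halving makes the closed box fit in the open ball of radius [e]. *)
pose r := e / 2; have r0 : 0 < r by rewrite divr_gt0.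
have r20 : 0 < r / 2 by rewrite divr_gt0.
have boxi : closed_box c r `<=` chart_cod i.
  move=> x xc; apply: ei; split=> // a b; rewrite (ord1 a) /ball /= ltr_norml.
  have := xc b; rewrite in_itv /= /r => /andP[h1 h2].
  by apply/andP; split; move: e0 h1 h2; lra.
pose V := chart_dom i `&` chart i @^-1` ball c (r / 2).
exists (chart_bump i c r), V, (chart_metric i c r); split; last first.
  by split; [exact: chart_atP|exact: ballxx].
split.
- by split; [exact: chart_bump_smooth|exact: chart_metric_smooth].
- move=> q; rewrite chart_bump_ge0//= /chart_bump; case: ifP => // _.
  exact: box_bump_le1.
- split.
    apply: open_setI_preimage; first exact: chart_dom_open.
      exact: chart_continuous.
    exact: ball_open.
  move=> q [iq qc]; rewrite chart_bump_in// box_bump_eq1// => a.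
  by rewrite distrC; apply/ltW; exact: (qc.2 0 a).
- by move=> q; exact: chart_metric_semi.
- by move=> q; exact: chart_metric_pos.
Qed.

(** A Lindelof argument: a base element contained in some admissible [V] selects such a piece at the
    index given by its code. The other indices get zero data with [V] empty, which satisfies
    [local_metric]. *)
Lemma local_metric_seq_exists :
  exists (f : nat -> M -> R) (V : nat -> set M) (h : nat -> M -> 'M[R]_m),
    (forall k, local_metric (f k) (V k) (h k)) /\ (forall q, exists k, V k q).
Proof.
have [B Bc [_ Bb]] := manifold_second_countable M.
have [code codeI] := (countable_injP _ Bc).
pose P (k : nat) (d : (M -> R) * set M * (M -> 'M[R]_m)) :=
  local_metric d.1.1 d.1.2 d.2 /\
  forall U, B U -> code U = k ->
    (exists f V h, local_metric f V h /\ U `<=` V) -> U `<=` d.1.2.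
have /choice[d dP] : forall k, exists d, P k d.
  move=> k.
  have [[U [BU Uk [f [V [h [loc UV]]]]]]|none] := pselect (exists U,
      [/\ B U, code U = k & exists f V h, local_metric f V h /\ U `<=` V]).
    exists (f, V, h); split=> // U' BU' U'k _.
    by have -> : U' = U by apply: codeI; rewrite ?inE// U'k.
  exists ((fun=> 0), set0, (fun=> 0)); split=> /=; last first.
    by move=> U BU Uk hU; case: none; exists U.
  split.
  - split=> i k'; first exact: Ck_cst.
    rewrite /tensor_coord; under eq_fun do rewrite mulmx0 mul0mx.
    exact: Ck_cst.
  - by move=> q; rewrite lexx ler01.
  - by split=> //; exact: open0.
  - by move=> q; exact: possemidef0.
  - by move=> q; rewrite ltxx.
exists (fun k => (d k).1.1), (fun k => (d k).1.2), (fun k => (d k).2); split.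
  by move=> k; case: (dP k).
move=> q; have [f [V [h [loc Vq]]]] := local_metric_exists q.
have nV : nbhs q V.
  by case: loc => _ _ [Vo _] _ _; exact: open_nbhs_nbhs.
have [U [BU Uq] UV] := Bb q V nV.
exists (code U); have [_ /(_ U BU erefl) dU] := dP (code U).
by apply: dU => //; exists f, V, h.
Qed.

(* On [V k] the factor [1 - f k = 0] kills all the terms of index larger than
   [k], so that the sum is locally finite without any paracompactness argument. *)
Lemma metric_exists :
  exists g : M -> 'M[R]_m, (forall q, posdef (g q)) /\ smooth_tensor g.
Proof.
have [f [V [h [loc cov]]]] := local_metric_seq_exists.
have /choice[N NP] := cov.
pose w (l : nat) q := \prod_(a < l) (1 - f a q).
pose s (n : nat) q := \sum_(l < n) w l q *: h l q.
have f01 k q : 0 <= f k q <= 1 by have [_ /(_ q)] := loc k.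
have fV k q : V k q -> f k q = 1 by have [_ _ [_ /(_ q)]] := loc k.
have w_ge0 (l : nat) q : 0 <= w l q.
  by apply: prodr_ge0 => a _; rewrite subr_ge0; case/andP: (f01 a q).
have s_stat k q n : V k q -> s (k.+1 + n)%N q = s k.+1 q.
  move=> Vq; elim: n => [|n IH]; first by rewrite addn0.
  have -> : s (k.+1 + n.+1)%N q = s (k.+1 + n)%N q + w (k.+1 + n)%N q *: h (k.+1 + n)%N q.
    by rewrite addnS /s big_ord_recr.
  rewrite IH /w.
  have kn : (k < k.+1 + n)%N by rewrite addSn ltnS leq_addr.
  by rewrite (bigD1 (Ordinal kn))//= fV// subrr mul0r scale0r addr0.
have s_eq k k' q : V k q -> V k' q -> s k.+1 q = s k'.+1 q.
  by move=> Vk Vk'; rewrite -(s_stat k q k'.+1 Vk) addnC (s_stat k' q k.+1 Vk').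
(* [N] is an arbitrary choice; by [s_eq] the value is independent of it, so a constant index can be
   used near a given point. *)
exists (fun q => s (N q).+1 q); split=> [q|i k].
- have ex : exists l : nat, 0 < f l q by exists (N q); rewrite fV// ltr01.
  (* At the least [l] with [f l q > 0] all earlier [f a q] vanish, so the weight is 1 and [h l q] is
     definite. *)
  case: (ex_minnP ex) => l fl lmin.
  have lN : (l < (N q).+1)%N by rewrite ltnS lmin// fV// ltr01.
  have wl : w l q = 1.
    apply: big1 => a _; suff -> : f a q = 0 by rewrite subr0.
    apply/eqP; rewrite eq_le; case/andP: (f01 a q) => -> _; rewrite andbT leNgt.
    by apply/negP => /lmin; rewrite leqNgt ltn_ord.
  rewrite /s (bigD1 (Ordinal lN))//= wl scale1r; apply: posdefDl.
    by have [_ _ _ _] := loc l; exact.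
  apply: possemidef_sum => a _; apply: possemidefZ => //.
  by have [_ _ _ + _] := loc a; exact.
apply: Ck_local => x xi; have [iq _] := chart_invP xi.
have [n Vn] := cov (chart_inv i x).
have Uo : open (chart_cod i `&` chart_inv i @^-1` V n).
  by apply: chart_cod_preimage_open; have [_ _ []] := loc n.
exists (chart_cod i `&` chart_inv i @^-1` V n) => //.
have : Ck k (chart_cod i `&` chart_inv i @^-1` V n) (fun y =>
    \sum_(l < n.+1) w l (chart_inv i y) *: tensor_coord i (h l) (chart_inv i y)).
  apply: Ck_sum => // l _; apply: Ck_scalemx => //.
    apply: Ck_prod => // a _; apply: CkD => //; first exact: Ck_cst.
    apply: CkN => //; apply: Ck_sub (@subIsetl _ _ _) _.
    by have [[+ _] _ _ _ _] := loc a; exact.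
  apply: Ck_sub (@subIsetl _ _ _) _.
  by have [[_ +] _ _ _ _] := loc l; exact.
apply: eq_Ck => // y [yi yV].
rewrite /tensor_coord (s_eq _ n)// /s mulmx_sumr mulmx_suml.
by apply: eq_bigr => l _; rewrite -scalemxAr -scalemxAl.
Qed.

End Metric.

(** * Structures on the tangent bundle *)

Section MatrixFields.
Context {R : realType} {m : nat} (M : smoothManifold R m).
Implicit Types (p q : M) (i j l : chart_index M) (x : 'rV[R]_m).

Definition mx_form p (W : 'M[R]_m) (X Y : tangent p) : R :=
  ((X : 'rV[R]_m) *m W *m (Y : 'rV[R]_m)^T) 0 0.

Fact mx_form_is_bilinear p (W : 'M[R]_m) :
  bilinear_for (GRing.Scale.Law.clone _ _ *%R _) (GRing.Scale.Law.clone _ _ *%R _)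
    (@mx_form p W).
Proof.
split=> [Y|X] a u v; rewrite /mx_form /=.
  by rewrite !mulmxDl -!scalemxAl !mxE.
by rewrite linearP /= mulmxDr -scalemxAr !mxE.
Qed.
HB.instance Definition _ p (W : 'M[R]_m) :=
  bilinear_isBilinear.Build R (tangent p) (tangent p) R _ _ (@mx_form p W)
    (mx_form_is_bilinear p W).

Definition mx_endo p (A : 'M[R]_m) (X : tangent p) : tangent p :=
  (X : 'rV[R]_m) *m A.

Fact mx_endo_is_linear p (A : 'M[R]_m) : linear (@mx_endo p A).
Proof. by move=> a X Y; rewrite /mx_endo mulmxDl -scalemxAl. Qed.
HB.instance Definition _ p (A : 'M[R]_m) :=
  GRing.isLinear.Build R (tangent p) (tangent p) _ (@mx_endo p A)
    (@mx_endo_is_linear p A).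

(** Covectors are columns, so the dual of right multiplication by [A] is left multiplication by [A];
    the sign makes the pairing invariant when [A] squares to -1. *)
Definition mx_gendo p (A : 'M[R]_m) (u : gtangent p) : gtangent p :=
  ((u.1 : 'rV[R]_m) *m A, - (A *m (u.2 : 'cV[R]_m))).

Fact mx_gendo_is_linear p (A : 'M[R]_m) : linear (@mx_gendo p A).
Proof.
move=> a u v; apply: injective_projections => /=.
  by rewrite mulmxDl -scalemxAl.
by rewrite mulmxDr -scalemxAr opprD scalerN.
Qed.
HB.instance Definition _ p (A : 'M[R]_m) :=
  GRing.isLinear.Build R (gtangent p) (gtangent p) _ (@mx_gendo p A)
    (@mx_gendo_is_linear p A).

Lemma mx_form_alt p (W : 'M[R]_m) (X : tangent p) : W^T = - W -> mx_form W X X = 0.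
Proof.
move=> Ws; have : ((X : 'rV[R]_m) *m W *m (X : 'rV[R]_m)^T)^T =
    - ((X : 'rV[R]_m) *m W *m (X : 'rV[R]_m)^T).
  by rewrite !trmx_mul trmxK Ws mulNmx mulmxN mulmxA.
move/matrixP/(_ 0 0); rewrite [LHS]mxE [RHS]mxE -/(mx_form W X X); lra.
Qed.

Definition form_mx p (w : {biscalar tangent p}) : 'M[R]_m :=
  \matrix_(a, b) w (delta_mx 0 a : 'rV[R]_m) (delta_mx 0 b : 'rV[R]_m).

Lemma form_mxE p (w : {biscalar tangent p}) X Y : w X Y = mx_form (form_mx w) X Y.
Proof.
transitivity (\sum_a \sum_b (X : 'rV_m) 0 a * (Y : 'rV_m) 0 b *
    w (delta_mx 0 a : 'rV[R]_m) (delta_mx 0 b : 'rV[R]_m)).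
  rewrite [X in w X _](row_sum_delta X) linear_sumlz.
  apply: eq_bigr => a _; rewrite linearZl_LR.
  rewrite [Y in w _ Y](row_sum_delta Y) linear_sumr mulr_sumr.
  by apply: eq_bigr => b _; rewrite linearZr_LR mulrA.
rewrite /mx_form mxE exchange_big /=; apply: eq_bigr => b _.
rewrite !mxE mulr_suml; apply: eq_bigr => a _; rewrite !mxE; ring.
Qed.

Definition endo_mx p (J : {linear tangent p -> tangent p}) : 'M[R]_m :=
  lin1_mx (J : 'rV[R]_m -> 'rV[R]_m).

Lemma endo_mxE p (J : {linear tangent p -> tangent p}) X : J X = mx_endo (endo_mx J) X.
Proof. exact/esym/(mul_rV_lin1 (J : {linear 'rV[R]_m -> 'rV[R]_m})). Qed.


Definition endo_coord i (A : M -> 'M[R]_m) p : 'M[R]_m :=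
  jac i (chart_at p) p *m A p *m jac (chart_at p) i p.

Definition smooth_endo (A : M -> 'M[R]_m) : Prop :=
  forall i, smooth_on (chart_cod i) (fun x => endo_coord i A (chart_inv i x)).

Lemma mx_form_tvec i (W : M -> 'M[R]_m) p (a b : 'rV[R]_m) :
  mx_form (W p) (tvec i p a) (tvec i p b) =
  (a *m tensor_coord i W p *m b^T) 0 0.
Proof. by rewrite /mx_form /tvec /tensor_coord trmx_mul !mulmxA. Qed.

Lemma mx_endo_tvec i (A : M -> 'M[R]_m) p (a : 'rV[R]_m) :
  tcoord i (mx_endo (A p) (tvec i p a)) = a *m endo_coord i A p.
Proof. by rewrite /tcoord /mx_endo /tvec /endo_coord !mulmxA. Qed.

Lemma Ck_entry (V : normedModType R) k (U : set V) a b
    (F : V -> 'M[R]_(a, b)) (i : 'I_a) (j : 'I_b) :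
  open U -> Ck k U F -> Ck k U (fun y => F y i j).
Proof. by move=> Uo /(Ck_mxP _ _ Uo); exact. Qed.

Lemma smooth_mx_form (W : M -> 'M[R]_m) :
  smooth_tensor W -> smooth_form (fun p => mx_form (W p) : {biscalar tangent p}).
Proof.
move=> Wk i a b k; have Uo := @chart_cod_open _ _ M i.
apply: (eq_Ck Uo (fun x _ => esym (mx_form_tvec i W (chart_inv i x) a b))).
have aWk := Ck_mulmx Uo (Ck_cst _ _ a) (Wk i k).
exact: Ck_entry Uo (Ck_mulmx Uo aWk (Ck_cst _ _ b^T)).
Qed.

Lemma smooth_form_mx (w : forall p, {biscalar tangent p}) :
  smooth_form w -> smooth_tensor (fun p => form_mx (w p)).
Proof.
move=> wk i k; have Uo := @chart_cod_open _ _ M i.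
apply/(Ck_mxP _ _ Uo) => a b.
have := wk i (delta_mx 0 a) (delta_mx 0 b) k.
apply: eq_Ck => // x _; rewrite [LHS]form_mxE.
rewrite (@mx_form_tvec i (fun p => form_mx (w p))) -rowE trmx_delta -colE.
by rewrite !mxE.
Qed.

Lemma smooth_mx_endo (A : M -> 'M[R]_m) : smooth_endo A ->
  smooth_tangent_endo (fun p => mx_endo (A p) : {linear tangent p -> tangent p}).
Proof.
move=> Ak i a k; have Uo := @chart_cod_open _ _ M i.
apply: (eq_Ck Uo (fun x _ => esym (mx_endo_tvec i A (chart_inv i x) a))).
by apply: Ck_mulmx => //; [exact: Ck_cst|exact: Ak].
Qed.

Lemma smooth_endo_mx (J : forall p, {linear tangent p -> tangent p}) :
  smooth_tangent_endo J -> smooth_endo (fun p => endo_mx (J p)).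
Proof.
move=> Jk i k; have Uo := @chart_cod_open _ _ M i.
apply/(Ck_mxP _ _ Uo) => a b.
apply: eq_Ck (Ck_entry 0 b Uo (Jk i (delta_mx 0 a) k)) => // x _.
rewrite -[LHS]/(tcoord i (J (chart_inv i x) (tvec i _ (delta_mx 0 a))) 0 b).
rewrite endo_mxE (@mx_endo_tvec i (fun p => endo_mx (J p))) -rowE.
by rewrite !mxE.
Qed.

Lemma almost_complex_mx (J : forall p, {linear tangent p -> tangent p}) p :
  almost_complex J -> endo_mx (J p) *m endo_mx (J p) = - 1%:M.
Proof.
move=> [_ JJ]; apply/row_matrixP => a; rewrite !rowE mulmxA mulmxN mulmx1.
have JE (X : tangent p) : J p X = (X : 'rV[R]_m) *m endo_mx (J p) by exact: endo_mxE.
by have := JJ p (delta_mx 0 a : 'rV[R]_m); rewrite !JE.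
Qed.

Lemma endo_coordE i (A : M -> 'M[R]_m) p : chart_dom i p ->
  endo_coord i A p = jac i (chart_at p) p *m A p *m invmx (jac i (chart_at p) p).
Proof. by move=> ip; rewrite invmx_jac//; exact: chart_atP. Qed.

(** * Passage between nondegenerate 2-forms and almost complex structures *)

Lemma almost_complex_of_form (w : forall p, {biscalar tangent p}) :
  two_form w -> nondegenerate_form w ->
  exists J : forall p, {linear tangent p -> tangent p}, almost_complex J.
Proof.
move=> [wk w0] wN; have [g [gp gk]] := metric_exists M.
pose W p := form_mx (w p).
have Ws p : (W p)^T = - W p.
  apply/matrixP => a b; rewrite !mxE; apply/eqP; rewrite -addr_eq0.
  set X : tangent p := delta_mx 0 b : 'rV[R]_m.
  set Y : tangent p := delta_mx 0 a : 'rV[R]_m.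
  have := w0 p (X + Y).
  by rewrite linearDl !linearDr !w0 add0r addr0 => ->.
have Wu p : W p \in unitmx.
  rewrite -row_free_unit; apply: inj_row_free => v vW.
  by apply: (wN p) => Y; rewrite form_mxE /mx_form vW mul0mx mxE.
pose A p := compat_acs (g p) (W p).
exists (fun p => mx_endo (A p) : {linear tangent p -> tangent p}); split.
  apply: smooth_mx_endo => i k; have Uo := @chart_cod_open _ _ M i.
  have Wk := smooth_form_mx wk.
  have : Ck k (chart_cod i) (fun x => compat_acs (tensor_coord i g (chart_inv i x))
      (tensor_coord i W (chart_inv i x))).
    apply: Ck_compat_acs => // [x /chart_invP[ip _]|x /chart_invP[ip _]||].
    - exact: tensor_coord_posdef.
    - have Tu := jac_unit ip (chart_atP (chart_inv i x)).
      by rewrite /tensor_coord !unitmx_mul unitmx_tr Tu Wu.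
    - exact: gk.
    - exact: Wk.
  apply: eq_Ck => // x /chart_invP[ip _].
  rewrite endo_coordE// /tensor_coord compat_acs_congr//.
  exact: jac_unit (chart_atP _).
by move=> p X; rewrite /= /mx_endo -mulmxA compat_acs_sqr// mulmxN mulmx1.
Qed.

Lemma form_of_almost_complex (J : forall p, {linear tangent p -> tangent p}) :
  almost_complex J ->
  exists w : forall p, {biscalar tangent p}, two_form w /\ nondegenerate_form w.
Proof.
move=> Jac; have [g [gp gk]] := metric_exists M.
pose A p := endo_mx (J p); have AA p : A p *m A p = - 1%:M by exact: almost_complex_mx.
pose W p := A p *m g p - g p *m (A p)^T.
exists (fun p => mx_form (W p) : {biscalar tangent p}); split; first split.
- apply: smooth_mx_form => i k; have Uo := @chart_cod_open _ _ M i.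
  have Ak : smooth_endo A by apply: smooth_endo_mx; case: Jac.
  have : Ck k (chart_cod i) (fun x =>
      endo_coord i A (chart_inv i x) *m tensor_coord i g (chart_inv i x) -
      tensor_coord i g (chart_inv i x) *m (endo_coord i A (chart_inv i x))^T).
    apply: CkD => //; last apply: CkN => //; apply: Ck_mulmx => //;
      by [exact: gk|exact: Ak|apply: Ck_trmx => //; exact: Ak].
  apply: eq_Ck => // x /chart_invP[ip _].
  have Tu := jac_unit ip (chart_atP (chart_inv i x)).
  rewrite endo_coordE// /tensor_coord /W; move: (jac _ _ _) Tu => T Tu.
  rewrite !trmx_mul trmx_inv !mulmxA mulmxKV// mulmxBr mulmxBl !mulmxA.
  by rewrite mulmxK// unitmx_tr.
- by move=> p X; apply: mx_form_alt; rewrite linearB /= !trmx_mul trmxK (gp p).1 opprB.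
- move=> p X XW; apply/eqP; apply: contraT => X0.
  (* Testing on [Y = J X] gives [g (J X, J X) + g (X, X)], because [J^2 = -1]. *)
  have := XW ((X : 'rV[R]_m) *m A p); rewrite /= /mx_form.
  rewrite /W mulmxBr mulmxBl trmx_mul !mulmxA.
  rewrite -(mulmxA _ (A p)^T (A p)^T) -trmx_mul AA linearN /= trmx1 mulmxN mulmx1.
  rewrite mulNmx opprK mxE => /eqP; rewrite gt_eqF// ltr_wpDl//; last exact: (gp p).2.
  by have := (posdef_semi (gp p)).2 ((X : 'rV[R]_m) *m A p); rewrite trmx_mul !mulmxA.
Qed.

(** Vectors and covectors transform by mutually inverse Jacobians, so the pairing has the same
    constant formula in every chart. *)
Lemma gcoord_gpairing i p (u v : gtangent p) : chart_dom i p ->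
  gpairing u v =
  2^-1 * (((gcoord i u).1 *m (gcoord i v).2) 0 0 + ((gcoord i v).1 *m (gcoord i u).2) 0 0).
Proof.
move=> ip; have tc (X : tangent p) (xi : cotangent p) : tcoord i X *m ccoord i xi = X *m xi.
  by rewrite /tcoord /ccoord mulmxA -(mulmxA (X : 'rV[R]_m)) jacK ?mulmx1//; exact: chart_atP.
by rewrite /gcoord !tc /gpairing /Defs.eval addrC.
Qed.

Lemma gvecK i p (c : 'rV[R]_m * 'cV[R]_m) : chart_dom i p -> gcoord i (gvec i p c) = c.
Proof.
move=> ip; have pp := chart_atP p; apply: injective_projections.
  by rewrite /= /tcoord /tvec -mulmxA jacK ?mulmx1.
by rewrite /= /ccoord /cvec mulmxA jacK ?mul1mx.
Qed.

Lemma generalized_of_almost_complex (J : forall p, {linear tangent p -> tangent p}) :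
  almost_complex J ->
  exists JJ : forall p, {linear gtangent p -> gtangent p}, generalized_almost_complex JJ.
Proof.
move=> Jac; pose A p := endo_mx (J p).
have AA p : A p *m A p = - 1%:M by exact: almost_complex_mx.
have Ak : smooth_endo A by apply: smooth_endo_mx; case: Jac.
exists (fun p => mx_gendo (A p) : {linear gtangent p -> gtangent p}); split.
- move=> i a k; have Uo := @chart_cod_open _ _ M i.
  have : Ck k (chart_cod i) (fun x => (a.1 *m endo_coord i A (chart_inv i x),
      - (endo_coord i A (chart_inv i x) *m a.2))).
    apply/(Ck_pairP _ _ Uo); split.
      by apply: Ck_mulmx => //; [exact: Ck_cst|exact: Ak].
    by apply: CkN => //; apply: Ck_mulmx => //; [exact: Ak|exact: Ck_cst].
  apply: eq_Ck => // x _; apply: injective_projections => /=.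
    by rewrite -mx_endo_tvec.
  by rewrite /ccoord /cvec /endo_coord mulmxN !mulmxA.
- move=> p u; apply: injective_projections => /=.
    by rewrite -mulmxA AA mulmxN mulmx1.
  by rewrite mulmxN opprK mulmxA AA mulNmx mul1mx.
- move=> p u v; rewrite /gpairing /Defs.eval /=; congr (_ * (_ + _)).
    by rewrite mulmxN -mulmxA (mulmxA (A p)) AA mulNmx mul1mx mulmxN opprK.
  by rewrite mulmxN -mulmxA (mulmxA (A p)) AA mulNmx mul1mx mulmxN opprK.
Qed.

(** * The 2-form induced by a generalized structure on the graph of a metric *)

Lemma gpairingC p (u v : gtangent p) : gpairing u v = gpairing v u.
Proof. by rewrite /gpairing addrC. Qed.

Fact gpairing_is_linear p (u : gtangent p) : scalar (gpairing u).
Proof.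
move=> a v w; rewrite /gpairing /Defs.eval /= mulmxDl mulmxDr -scalemxAl -scalemxAr.
by rewrite !mxE; ring.
Qed.
HB.instance Definition _ p (u : gtangent p) :=
  GRing.isLinear.Build R (gtangent p) R _ (gpairing u) (gpairing_is_linear u).

Definition graph p (g : 'M[R]_m) (X : tangent p) : gtangent p :=
  (X, g *m (X : 'rV[R]_m)^T).

Fact graph_is_linear p (g : 'M[R]_m) : linear (@graph p g).
Proof.
move=> a X Y; apply: injective_projections => //=.
by rewrite linearP mulmxDr -scalemxAr.
Qed.
HB.instance Definition _ p (g : 'M[R]_m) :=
  GRing.isLinear.Build R (tangent p) (gtangent p) _ (@graph p g) (@graph_is_linear p g).

Definition graph_form p (g : 'M[R]_m) (J : {linear gtangent p -> gtangent p})
  (X Y : tangent p) : R := gpairing (J (graph g X)) (graph g Y).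

Fact graph_form_is_bilinear p g (J : {linear gtangent p -> gtangent p}) :
  bilinear_for (GRing.Scale.Law.clone _ _ *%R _) (GRing.Scale.Law.clone _ _ *%R _)
    (graph_form g J).
Proof.
split=> [Y|X] a u v; rewrite /graph_form /=; last by rewrite !linearP.
by rewrite !linearP gpairingC linearP /= !(gpairingC (graph g Y)).
Qed.
HB.instance Definition _ p g (J : {linear gtangent p -> gtangent p}) :=
  bilinear_isBilinear.Build R (tangent p) (tangent p) R _ _ (graph_form g J)
    (graph_form_is_bilinear g J).

Lemma graph_tvec i (g : M -> 'M[R]_m) p (a : 'rV[R]_m) : chart_dom i p ->
  graph (g p) (tvec i p a) = gvec i p (a, tensor_coord i g p *m a^T).
Proof.
move=> ip; congr (_, _); rewrite /cvec /= /tvec /tensor_coord trmx_mul !mulmxA.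
by rewrite jacK ?mul1mx//; exact: chart_atP.
Qed.

Fact gvec_is_linear i p : linear (@gvec _ _ M i p).
Proof.
move=> a u v; apply: injective_projections; rewrite /= /tvec /cvec.
  by rewrite mulmxDl -scalemxAl.
by rewrite mulmxDr -scalemxAr.
Qed.

Fact gcoord_is_linear i p : linear (@gcoord _ _ M i p).
Proof.
move=> a u v; apply: injective_projections; rewrite /= /tcoord /ccoord.
  by rewrite mulmxDl -scalemxAl.
by rewrite mulmxDr -scalemxAr.
Qed.
HB.instance Definition _ i p :=
  GRing.isLinear.Build R _ (gtangent p) _ (@gvec _ _ M i p) (@gvec_is_linear i p).
HB.instance Definition _ i p :=
  GRing.isLinear.Build R (gtangent p) _ _ (@gcoord _ _ M i p) (@gcoord_is_linear i p).

(** [smooth_gtangent_endo] speaks only of fields with constant coordinates, whereas those of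
    [graph g X] vary with the metric. By linearity such a field is expanded in the standard basis
    with coefficients of class [k]. *)
Lemma Ck_gendo i (J : forall p, {linear gtangent p -> gtangent p}) k
    (c : 'rV[R]_m -> 'rV[R]_m * 'cV[R]_m) :
  smooth_gtangent_endo J -> Ck k (chart_cod i) c ->
  Ck k (chart_cod i) (fun x => gcoord i (J (chart_inv i x) (gvec i (chart_inv i x) (c x)))).
Proof.
move=> Jk ck; have Uo := @chart_cod_open _ _ M i.
pose F x (d : 'rV[R]_m * 'cV[R]_m) := gcoord i (J (chart_inv i x) (gvec i (chart_inv i x) d)).
have [/(Ck_mxP _ _ Uo) c1 /(Ck_mxP _ _ Uo) c2] := (Ck_pairP _ _ Uo).1 ck.
have Fk d : Ck k (chart_cod i) (F ^~ d) by exact: Jk.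
have FZ (s : 'rV[R]_m -> R) d : Ck k (chart_cod i) s ->
    Ck k (chart_cod i) (fun x => s x *: F x d).
  move=> sk; have [F1 F2] := (Ck_pairP _ _ Uo).1 (Fk d).
  by apply/(Ck_pairP _ _ Uo); split; exact: Ck_scalemx.
have : Ck k (chart_cod i) (fun x =>
    \sum_a (c x).1 0 a *: F x (delta_mx 0 a, 0) + \sum_a (c x).2 a 0 *: F x (0, delta_mx a 0)).
  by apply: CkD => //; apply: Ck_sum => // a _; apply: FZ; [exact: c1|exact: c2].
apply: eq_Ck => // x _; rewrite -/(F x (c x)).
have FD d e : F x (d + e) = F x d + F x e by rewrite /F !linearD.
have FS s d : F x (s *: d) = s *: F x d by rewrite /F !linearZ.
have Fsum (I : finType) (d : I -> 'rV[R]_m * 'cV[R]_m) :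
    F x (\sum_a d a) = \sum_a F x (d a) by rewrite /F !linear_sum.
have cE : c x = \sum_a (c x).1 0 a *: ((delta_mx 0 a : 'rV[R]_m), (0 : 'cV[R]_m)) +
    \sum_a (c x).2 a 0 *: ((0 : 'rV[R]_m), (delta_mx a 0 : 'cV[R]_m)).
  have fst_sum (f : 'I_m -> 'rV[R]_m * 'cV[R]_m) : (\sum_a f a).1 = \sum_a (f a).1.
    exact: raddf_sum.
  have snd_sum (f : 'I_m -> 'rV[R]_m * 'cV[R]_m) : (\sum_a f a).2 = \sum_a (f a).2.
    exact: raddf_sum.
  apply: injective_projections; rewrite /= ?fst_sum ?snd_sum /=.
    rewrite [X in _ + X]big1 ?addr0 => [|a _]; last by rewrite scaler0.
    exact: row_sum_delta.
  rewrite [X in X + _]big1 ?add0r => [|a _]; last by rewrite scaler0.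
  rewrite [LHS]matrix_sum_delta; apply: eq_bigr => a _.
  by rewrite big_ord1.
rewrite [in RHS]cE FD !Fsum.
by congr (_ + _); apply: eq_bigr => a _; rewrite FS.
Qed.

Lemma form_of_generalized (J : forall p, {linear gtangent p -> gtangent p}) :
  generalized_almost_complex J ->
  exists w : forall p, {biscalar tangent p}, two_form w /\ nondegenerate_form w.
Proof.
move=> [Jk JJ Jo]; have [g [gp gk]] := metric_exists M.
exists (fun p => graph_form (g p) (J p) : {biscalar tangent p}); split; first split.
- move=> i a b k; have Uo := @chart_cod_open _ _ M i.
  pose gam x := gcoord i (J (chart_inv i x)
    (gvec i (chart_inv i x) (a, tensor_coord i g (chart_inv i x) *m a^T))).
  have gamk : Ck k (chart_cod i) gam.
    apply: (Ck_gendo Jk); apply/(Ck_pairP _ _ Uo); split; first exact: Ck_cst.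
    by apply: Ck_mulmx => //; [exact: gk|exact: Ck_cst].
  have [g1 g2] := (Ck_pairP _ _ Uo).1 gamk.
  have : Ck k (chart_cod i) (fun x => 2^-1 *
     (((gam x).1 *m (tensor_coord i g (chart_inv i x) *m b^T)) 0 0 +
      (b *m (gam x).2) 0 0)).
    apply: CkM => //; first exact: Ck_cst.
    apply: CkD => //.
      apply: (Ck_entry 0 0 Uo (Ck_mulmx Uo g1 (Ck_mulmx Uo _ (Ck_cst _ _ b^T)))).
      exact: gk.
    exact: (Ck_entry 0 0 Uo (Ck_mulmx Uo (Ck_cst _ _ b) g2)).
  apply: eq_Ck => // x /chart_invP[ip _].
  rewrite -[RHS]/(graph_form _ (J (chart_inv i x)) (tvec i _ a) (tvec i _ b)).
  rewrite /graph_form (gcoord_gpairing _ _ ip) !graph_tvec//.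
  by rewrite gvecK.
- move=> p X; rewrite -[LHS]/(gpairing (J p (graph (g p) X)) (graph (g p) X)).
  (* [<J u, u> = <J J u, J u> = - <u, J u>], and the pairing is symmetric. *)
  set u := graph _ X; have : gpairing (J p u) u = - gpairing (J p u) u.
    by rewrite -{1}Jo JJ gpairingC linearN.
  lra.
- move=> p X Xw; apply/eqP; apply: contraT => X0.
  set u := graph (g p) X; pose v := J p u.
  (* Testing on the tangent part of [v = J u] gives [v.2 (v.1) = - g (v.1, v.1) <= 0], while [v.2
     (v.1) = <v, v> = <u, u> = g (X, X) > 0]. *)
  have := Xw v.1.
  rewrite -[LHS]/(gpairing v (graph (g p) v.1)) /gpairing /Defs.eval /= => h.
  have := Jo p u u; rewrite -/v /gpairing /Defs.eval /=.
  have := (gp p).2 _ X0; rewrite -mulmxA.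
  have := (posdef_semi (gp p)).2 v.1; rewrite -mulmxA.
  move: h; lra.
Qed.

End MatrixFields.

Theorem proposition4p15 (R : realType) (n : nat) (M : smoothManifold R (2 * n)%N) :
  ((exists J : forall p : M, {linear gtangent p -> gtangent p},
      generalized_almost_complex J) <->
   (exists J : forall p : M, {linear tangent p -> tangent p},
      almost_complex J)) /\
  ((exists J : forall p : M, {linear tangent p -> tangent p},
      almost_complex J) <->
   (exists w : forall p : M, {biscalar tangent p},
      two_form w /\ nondegenerate_form w)).
Proof.
have acs_of_form : (exists w : forall p : M, {biscalar tangent p},
    two_form w /\ nondegenerate_form w) ->
  exists J : forall p : M, {linear tangent p -> tangent p}, almost_complex J.
  by move=> [w [wk wN]]; exact: almost_complex_of_form wk wN.
split; split=> //.
- by move=> [J /form_of_generalized/acs_of_form].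
- by move=> [J]; exact: generalized_of_almost_complex.
- by move=> [J]; exact: form_of_almost_complex.
Qed.
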